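(* The system $$y^{l,k}_{i,j}=\frac{1}{\sqrt{[2]_q^{\,j}\,d_{l,i}\,d_{l,j}\,c_{l,k}}}\;f_1^i f_3^j f_2^l f_\theta^k 1_\lambda,\qquad l,k\in\mathbb{Z}_+,\quad i,j\in\mathbb{Z}_+,\ i,j\leqslant l,$$ where $$d_{l,m}=(-1)^m q^{-m(l-m+1)}[m]_q[l-m+1]_q$$ and $c_{l,k}=\langle f_2^l f_\theta^k 1_\lambda, f_2^l f_\theta^k 1_\lambda\rangle$, is an orthonormal basis with respect to the contravariant form $\langle\cdot,\cdot\rangle$ on the base module $M$ (normalized by $\langle 1_\lambda,1_\lambda\rangle=1$).
   Context: $q$ is a nonzero complex number, not a root of unity; $\bar q=q^{-1}$, $[x,y]_a=xy-ayx$, $[x,y]=[x,y]_1$, $[n]_q=\frac{q^n-q^{-n}}{q-q^{-1}}$, $\mathbb{Z}_+=\{0,1,2,\dots\}$. Fix a logarithm of $q$. $\mathfrak{g}=\mathfrak{sp}(6)$ with Cartan subalgebra $\mathfrak{h}$; $\varepsilon_1,\varepsilon_2,\varepsilon_3$ is an orthonormal basis of $\mathfrak{h}^*$; simple roots are $\alpha_1=\varepsilon_1-\varepsilon_2$, $\alpha_2=\varepsilon_2-\varepsilon_3$, $\alpha_3=2\varepsilon_3$. $U_q(\mathfrak{g})$ is the unital algebra generated by $e_i,f_i,q^{\pm h_i}$ ($i=1,2,3$), with the $q^{\pm h_i}$ commuting and invertible, $q^{h_i}e_j=q^{(\alpha_i,\alpha_j)}e_jq^{h_i}$, $q^{h_i}f_j=q^{-(\alpha_i,\alpha_j)}f_jq^{h_i}$,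 $[e_i,f_j]=\delta_{ij}\frac{q^{h_i}-q^{-h_i}}{q-q^{-1}}$, $[e_1,e_3]=0$, $[e_i,[e_i,e_j]_q]_{\bar q}=0$ for $\{i,j\}=\{1,2\}$, $[e_2,[e_2,[e_2,e_3]_{q^2}]]_{\bar q^2}=0$, $[e_3,[e_3,e_2]_{\bar q^2}]_{q^2}=0$, and the same relations with all $e$ replaced by $f$. A nonzero vector has weight $\mu\in\mathfrak{h}^*$ if $q^{h_i}$ acts on it by $q^{(\alpha_i,\mu)}$ for all $i$. Base weight: fix $\lambda\in\mathfrak{h}^*$ with $q^{(\lambda,\alpha_1)}=1=q^{(\lambda,\alpha_3)}$ and $q^{2(\lambda,\varepsilon_1)}=q^{2(\lambda,\varepsilon_2)}=-q^{-2}$. Put $f_\delta=f_2^2f_3-(q^2+\bar q^2)f_2f_3f_2+f_3f_2^2$. The base module $M$ is the quotient of the Verma module of highest weight $\lambda$ and highest vector $1_\lambda$ by the submodule generated by the singular vectors $f_11_\lambda$, $f_31_\lambda$, $f_\delta1_\lambda$; the image of $1_\lambda$ in $M$ is denoted by the same symbol. $f_\xi=[[f_1,f_2]_{\bar q},f_3]_{\bar q^2}$ and $f_\theta=[f_2,f_\xi]_q$. Let $\omega$ be the involutive algebra anti-automorphism of $U_q(\mathfrak{g})$ with $\omega(q^{\pm h_i})=q^{\pm h_i}$, $\omega(e_i)=-f_iq^{h_i}$, $\omega(f_i)=-q^{-h_i}e_i$. A symmetric bilinear form on a $U_q(\mathfrak{g})$-module is contravariant if $\langle xv,w\rangle=\langle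 v,\omega(x)w\rangle$ for all $x\in U_q(\mathfrak{g})$ and all vectors $v,w$; every highest weight module has a unique contravariant form normalized to $1$ on the highest vector.
   Formalization: The printed d_{l,m} vanishes at m=0 and gives wrong norms; it is replaced by (-1)^m q^{-m(l-m+1)} times the product over s=1..m of [s]_q[l-s+1]_q, with q replaced by q^2 in the factor d_{l,j} for f_3^j. *)

(* Defs.v *)
From HB Require Import structures.
From mathcomp Require Import all_boot all_order all_algebra.
From mathcomp Require Import complex.
From mathcomp Require Import boolp reals sequences exp trigo.
From mathcomp Require Import finmap.
From mathcomp.multinomials Require Import monalg.

Set Implicit Arguments.
Unset Strict Implicit.
Unset Printing Implicit Defensive.

Import GRing.Theory.
Local Open Scope ring_scope.
Local Open Scope quotient_scope.

(** * Quotient of a module by a generated submodule *)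

Section QuotientModule.
Variables (R : nzRingType) (V : lmodType R) (G : V -> Prop).

Definition submod_gen : {pred V} := fun v =>
  `[< forall S : {pred V}, submod_closed S ->
        (forall g, G g -> g \in S) -> v \in S >].

Lemma submod_genP v : reflect (forall S : {pred V}, submod_closed S ->
  (forall g, G g -> g \in S) -> v \in S) (v \in submod_gen).
Proof. exact: asboolP. Qed.

Lemma submod_gen_submod : submod_closed submod_gen.
Proof.
split; first by apply/submod_genP => S [].
move=> a u v /submod_genP hu /submod_genP hv.
apply/submod_genP => S cS GS; case: (cS) => _; apply; [exact: hu|exact: hv].
Qed.

Lemma submod_gen_zmod : zmod_closed submod_gen.
Proof. exact: GRing.submod_closedB submod_gen_submod. Qed.

HB.instance Definition _ := GRing.isZmodClosed.Build V submod_gen submod_gen_zmod.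

Definition quot_mod : Type := Quotient.quot submod_gen.

HB.instance Definition _ := GRing.Zmodule.on quot_mod.

Definition to_quot_mod (v : V) : quot_mod := \pi_(Quotient.quot submod_gen) v.

Lemma to_quot_modE u v :
  to_quot_mod u = to_quot_mod v <-> u - v \in submod_gen.
Proof.
by rewrite Quotient.idealrBE; split=> [h|/eqP//]; apply/eqP.
Qed.

Let rp (u : quot_mod) : V := repr (u : Quotient.quot submod_gen).
Let rpK u : to_quot_mod (rp u) = u. Proof. exact: reprK. Qed.
Lemma to_quot_mod_surj (u : quot_mod) : exists v, u = to_quot_mod v.
Proof. by exists (rp u); rewrite rpK. Qed.

Lemma to_quot_modD u v : to_quot_mod (u + v) = to_quot_mod u + to_quot_mod v.
Proof. exact: (Quotient.pi_add submod_gen). Qed.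

Definition quot_mod_scale (a : R) (u : quot_mod) : quot_mod :=
  to_quot_mod (a *: rp u).

Lemma to_quot_modZ a v : to_quot_mod (a *: v) = quot_mod_scale a (to_quot_mod v).
Proof.
apply/to_quot_modE; rewrite -scalerBr.
have h : v - rp (to_quot_mod v) \in submod_gen by apply/to_quot_modE; rewrite rpK.
case: submod_gen_submod => h0 hl.
by rewrite -[_ *: _]addr0; apply: hl.
Qed.

Fact quot_mod_scaleA a b v :
  quot_mod_scale a (quot_mod_scale b v) = quot_mod_scale (a * b) v.
Proof.
by case: (to_quot_mod_surj v) => w ->; rewrite -!to_quot_modZ scalerA.
Qed.
Fact quot_mod_scale1 : left_id 1 quot_mod_scale.
Proof. by move=> v; case: (to_quot_mod_surj v) => w ->; rewrite -to_quot_modZ scale1r. Qed.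
Fact quot_mod_scaleDr : right_distributive quot_mod_scale +%R.
Proof.
move=> a u v; case: (to_quot_mod_surj u) => u' ->; case: (to_quot_mod_surj v) => v' ->.
by rewrite -to_quot_modD -!to_quot_modZ scalerDr to_quot_modD.
Qed.
Fact quot_mod_scaleDl v :
  {morph quot_mod_scale^~ v : a b / a + b >-> a + b}.
Proof.
move=> a b; case: (to_quot_mod_surj v) => w ->.
by rewrite -!to_quot_modZ scalerDl to_quot_modD.
Qed.

HB.instance Definition _ := GRing.Zmodule_isLmodule.Build R quot_mod
  quot_mod_scaleA quot_mod_scale1 quot_mod_scaleDr quot_mod_scaleDl.

Fact to_quot_mod_linear : linear to_quot_mod.
Proof. by move=> a u v; rewrite to_quot_modD to_quot_modZ. Qed.

HB.instance Definition _ :=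
  GRing.isLinear.Build R V quot_mod *:%R to_quot_mod to_quot_mod_linear.

End QuotientModule.

(** * Quotient of an algebra by the two-sided ideal generated by relations *)

Section QuotientAlgebra.
Variables (K : fieldType) (A : algType K) (rel : A -> A -> Prop).

Definition ideal2_closed (S : {pred A}) :=
  [/\ zmod_closed S, forall a x, x \in S -> a * x \in S
    & forall a x, x \in S -> x * a \in S].

Definition ideal2_gen : {pred A} := fun x =>
  `[< forall S : {pred A}, ideal2_closed S ->
        (forall u v, rel u v -> u - v \in S) -> x \in S >].

Lemma ideal2_genP x : reflect (forall S : {pred A}, ideal2_closed S ->
  (forall u v, rel u v -> u - v \in S) -> x \in S) (x \in ideal2_gen).
Proof. exact: asboolP. Qed.

Lemma ideal2_gen_closed : ideal2_closed ideal2_gen.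
Proof.
split.
- split=> [|x y /ideal2_genP hx /ideal2_genP hy]; apply/ideal2_genP => S cS GS;
    case: (cS) => -[S0 SB] _ _ //.
  by apply: SB; [exact: hx|exact: hy].
- move=> a x /ideal2_genP hx; apply/ideal2_genP => S cS GS; case: (cS) => _ h _.
  by apply: h; exact: hx.
- move=> a x /ideal2_genP hx; apply/ideal2_genP => S cS GS; case: (cS) => _ _ h.
  by apply: h; exact: hx.
Qed.

Lemma ideal2_gen_zmod : zmod_closed ideal2_gen.
Proof. by case: ideal2_gen_closed. Qed.

HB.instance Definition _ := GRing.isZmodClosed.Build A ideal2_gen ideal2_gen_zmod.

Variable proper : 1 \notin ideal2_gen.

Definition quot_alg (_ : 1 \notin ideal2_gen) : Type := Quotient.quot ideal2_gen.
Local Notation Q := (quot_alg proper).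

HB.instance Definition _ := GRing.Zmodule.on Q.

Definition to_quot_alg (x : A) : Q := \pi_(Quotient.quot ideal2_gen) x.
Local Notation p := to_quot_alg.

Lemma to_quot_algE x y : p x = p y <-> x - y \in ideal2_gen.
Proof. by rewrite Quotient.idealrBE; split=> [h|/eqP//]; apply/eqP. Qed.

Let rp (u : Q) : A := repr (u : Quotient.quot ideal2_gen).
Let rpK u : p (rp u) = u. Proof. exact: reprK. Qed.
Lemma to_quot_alg_surj (u : Q) : exists x, u = p x.
Proof. by exists (rp u); rewrite rpK. Qed.

Let rp_sub x : x - rp (p x) \in ideal2_gen.
Proof. by apply/to_quot_algE; rewrite rpK. Qed.

Lemma to_quot_algD x y : p (x + y) = p x + p y.
Proof. exact: (Quotient.pi_add ideal2_gen). Qed.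

Definition quot_alg_mul (u v : Q) : Q := p (rp u * rp v).
Definition quot_alg_scale (a : K) (u : Q) : Q := p (a *: rp u).

Lemma to_quot_algM x y : p (x * y) = quot_alg_mul (p x) (p y).
Proof.
apply/to_quot_algE; case: ideal2_gen_closed => _ hl hr.
rewrite -[_ * _](addrNK (x * rp (p y))) -addrA -mulrBr -mulrBl rpredD //.
- by apply: hl; exact: rp_sub.
- by apply: hr; exact: rp_sub.
Qed.

Lemma to_quot_algZ a x : p (a *: x) = quot_alg_scale a (p x).
Proof.
apply/to_quot_algE; case: ideal2_gen_closed => _ hl _.
by rewrite -scalerBr -[_ - _]mul1r scalerAl; apply: hl; exact: rp_sub.
Qed.

Fact quot_alg_mulA : associative quot_alg_mul.
Proof.
move=> u v w; case: (to_quot_alg_surj u) (to_quot_alg_surj v) (to_quot_alg_surj w).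
by move=> x -> [y ->] [z ->]; rewrite -!to_quot_algM mulrA.
Qed.
Fact quot_alg_mul1l : left_id (p 1) quot_alg_mul.
Proof. by move=> u; case: (to_quot_alg_surj u) => x ->; rewrite -to_quot_algM mul1r. Qed.
Fact quot_alg_mul1r : right_id (p 1) quot_alg_mul.
Proof. by move=> u; case: (to_quot_alg_surj u) => x ->; rewrite -to_quot_algM mulr1. Qed.
Fact quot_alg_mulDl : left_distributive quot_alg_mul +%R.
Proof.
move=> u v w; case: (to_quot_alg_surj u) (to_quot_alg_surj v) (to_quot_alg_surj w).
move=> x -> [y ->] [z ->].
by rewrite -to_quot_algD -!to_quot_algM mulrDl to_quot_algD.
Qed.
Fact quot_alg_mulDr : right_distributive quot_alg_mul +%R.
Proof.
move=> u v w; case: (to_quot_alg_surj u) (to_quot_alg_surj v) (to_quot_alg_surj w).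
move=> x -> [y ->] [z ->].
by rewrite -to_quot_algD -!to_quot_algM mulrDr to_quot_algD.
Qed.
Fact quot_alg_1neq0 : p 1 != 0.
Proof.
rewrite -[0](_ : p 0 = 0); last first.
  by apply: (addrI (p 0)); rewrite -to_quot_algD !addr0.
by apply/eqP => /to_quot_algE; rewrite subr0; apply/negP.
Qed.

HB.instance Definition _ := GRing.Zmodule_isNzRing.Build Q
  quot_alg_mulA quot_alg_mul1l quot_alg_mul1r
  quot_alg_mulDl quot_alg_mulDr quot_alg_1neq0.

Fact quot_alg_scaleA a b v :
  quot_alg_scale a (quot_alg_scale b v) = quot_alg_scale (a * b) v.
Proof. by case: (to_quot_alg_surj v) => w ->; rewrite -!to_quot_algZ scalerA. Qed.
Fact quot_alg_scale1 : left_id 1 quot_alg_scale.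
Proof. by move=> v; case: (to_quot_alg_surj v) => w ->; rewrite -to_quot_algZ scale1r. Qed.
Fact quot_alg_scaleDr : right_distributive quot_alg_scale +%R.
Proof.
move=> a u v; case: (to_quot_alg_surj u) (to_quot_alg_surj v) => x -> [y ->].
by rewrite -to_quot_algD -!to_quot_algZ scalerDr to_quot_algD.
Qed.
Fact quot_alg_scaleDl v :
  {morph quot_alg_scale^~ v : a b / a + b >-> a + b}.
Proof.
move=> a b; case: (to_quot_alg_surj v) => w ->.
by rewrite -!to_quot_algZ scalerDl to_quot_algD.
Qed.

HB.instance Definition _ := GRing.Zmodule_isLmodule.Build K Q
  quot_alg_scaleA quot_alg_scale1 quot_alg_scaleDr quot_alg_scaleDl.

Fact quot_alg_scaleAl (a : K) (u v : Q) : a *: (u * v) = (a *: u) * v.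
Proof.
case: (to_quot_alg_surj u) (to_quot_alg_surj v) => x -> [y ->].
by rewrite -[_ *: p x]to_quot_algZ -[_ * _]to_quot_algM -[LHS]to_quot_algZ
  -[RHS]to_quot_algM scalerAl.
Qed.

HB.instance Definition _ := GRing.Lmodule_isLalgebra.Build K Q quot_alg_scaleAl.

Fact quot_alg_scaleAr (a : K) (u v : Q) : a *: (u * v) = u * (a *: v).
Proof.
case: (to_quot_alg_surj u) (to_quot_alg_surj v) => x -> [y ->].
by rewrite -[_ *: p y]to_quot_algZ -[_ * _]to_quot_algM -[LHS]to_quot_algZ
  -[RHS]to_quot_algM scalerAr.
Qed.

HB.instance Definition _ := GRing.Lalgebra_isAlgebra.Build K Q quot_alg_scaleAr.

Fact to_quot_alg_linear : linear to_quot_alg.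
Proof. by move=> a u v; rewrite to_quot_algD to_quot_algZ. Qed.

HB.instance Definition _ :=
  GRing.isLinear.Build K A Q *:%R to_quot_alg to_quot_alg_linear.

Fact to_quot_alg_monoid : monoid_morphism to_quot_alg.
Proof. by split=> // x y; exact: to_quot_algM. Qed.

HB.instance Definition _ :=
  GRing.isMonoidMorphism.Build A Q to_quot_alg to_quot_alg_monoid.

End QuotientAlgebra.

(** * The quantized universal enveloping algebra of sp(6) *)

Definition qcomm (K : fieldType) (A : algType K) (a : K) (x y : A) : A :=
  x * y - a *: (y * x).

Definition qint (K : fieldType) (q : K) (n : nat) : K :=
  (q ^+ n - q ^- n) / (q - q^-1).

(* The nodes 1, 2, 3 of the Dynkin diagram; node 3 carries the long root. *)
Definition n1 : 'I_3 := @Ordinal 3 0 isT.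
Definition n2 : 'I_3 := @Ordinal 3 1 isT.
Definition n3 : 'I_3 := @Ordinal 3 2 isT.

(* Elements of the dual Cartan subalgebra are row vectors of coordinates in
   the orthonormal basis eps n1, eps n2, eps n3. *)
Definition eps (R : nzRingType) (i : 'I_3) : 'rV[R]_3 := delta_mx 0 i.

Definition pairing (R : nzRingType) (u v : 'rV[R]_3) : R :=
  \sum_(i < 3) u 0 i * v 0 i.

Definition simple_root (R : nzRingType) (i : 'I_3) : 'rV[R]_3 :=
  if i == n1 then eps R n1 - eps R n2
  else if i == n2 then eps R n2 - eps R n3
  else eps R n3 *+ 2.

Definition root_pairing (i j : 'I_3) : int :=
  pairing (simple_root int i) (simple_root int j).

Inductive gen := GenE of 'I_3 | GenF of 'I_3 | GenK of 'I_3 | GenKV of 'I_3.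

Definition gen_code (g : gen) : ('I_3 + 'I_3) + ('I_3 + 'I_3) :=
  match g with
  | GenE i => inl (inl i) | GenF i => inl (inr i)
  | GenK i => inr (inl i) | GenKV i => inr (inr i)
  end.
Definition gen_decode (s : ('I_3 + 'I_3) + ('I_3 + 'I_3)) : gen :=
  match s with
  | inl (inl i) => GenE i | inl (inr i) => GenF i
  | inr (inl i) => GenK i | inr (inr i) => GenKV i
  end.
Lemma gen_codeK : cancel gen_code gen_decode. Proof. by case. Qed.
HB.instance Definition _ := Choice.copy gen (can_type gen_codeK).

(* The free associative algebra is the monoid algebra of the free monoid. *)
Definition free_alg (K : fieldType) : Type := {malg K[{fmonom gen}]}.
HB.instance Definition _ (K : fieldType) := GRing.Lalgebra.on (free_alg K).

Lemma scaleAr_central (K : fieldType) (A : lalgType K) (a : K) (x y : A) :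
  x * a%:A = a *: x -> a *: (x * y) = x * (a *: y).
Proof. by move=> h; rewrite scalerAl -h -mulrA -scalerAl mul1r. Qed.

Fact free_alg_scaleAr (K : fieldType) (a : K) (x y : free_alg K) :
  a *: (x * y) = x * (a *: y).
Proof.
apply: scaleAr_central; rewrite -[a%:A]mul_malgC mulr1.
apply: etrans (fgmulgU _ _ _) _; apply: etrans _ (mul_malgC a x).
apply: etrans _ (esym (fgmulUg _ _ _)).
by apply: eq_bigr => m _; rewrite mulrC mul1m mulm1.
Qed.
HB.instance Definition _ (K : fieldType) :=
  GRing.Lalgebra_isAlgebra.Build K (free_alg K) (@free_alg_scaleAr K).

HB.lock Definition free_gen (K : fieldType) (g : gen) : free_alg K := << fmu g >>.

(* The defining relations, in an algebra with elements e i, f i, k i = q^{h_i}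
   and kV i = q^{- h_i} *)
Section UqRelations.
Variables (K : fieldType) (q : K) (A : algType K) (e f k kV : 'I_3 -> A).

Variant uq_rel : A -> A -> Prop :=
| UqKKV i : uq_rel (k i * kV i) 1
| UqKVK i : uq_rel (kV i * k i) 1
| UqKK i j : uq_rel (k i * k j) (k j * k i)
| UqKE i j : uq_rel (k i * e j) (q ^ root_pairing i j *: (e j * k i))
| UqKF i j : uq_rel (k i * f j) (q ^ (- root_pairing i j) *: (f j * k i))
| UqEF i j : uq_rel (qcomm 1 (e i) (f j))
    ((i == j)%:R *: ((q - q^-1)^-1 *: (k i - kV i)))
| UqE13 : uq_rel (qcomm 1 (e n1) (e n3)) 0
| UqE12 : uq_rel (qcomm q^-1 (e n1) (qcomm q (e n1) (e n2))) 0
| UqE21 : uq_rel (qcomm q^-1 (e n2) (qcomm q (e n2) (e n1))) 0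
| UqE23 : uq_rel
    (qcomm (q ^- 2) (e n2) (qcomm 1 (e n2) (qcomm (q ^+ 2) (e n2) (e n3)))) 0
| UqE32 : uq_rel (qcomm (q ^+ 2) (e n3) (qcomm (q ^- 2) (e n3) (e n2))) 0
| UqF13 : uq_rel (qcomm 1 (f n1) (f n3)) 0
| UqF12 : uq_rel (qcomm q^-1 (f n1) (qcomm q (f n1) (f n2))) 0
| UqF21 : uq_rel (qcomm q^-1 (f n2) (qcomm q (f n2) (f n1))) 0
| UqF23 : uq_rel
    (qcomm (q ^- 2) (f n2) (qcomm 1 (f n2) (qcomm (q ^+ 2) (f n2) (f n3)))) 0
| UqF32 : uq_rel (qcomm (q ^+ 2) (f n3) (qcomm (q ^- 2) (f n3) (f n2))) 0.

Lemma uq_rel_counit (c : A -> K) :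
    c 1 = 1 -> {morph c : x y / x * y} -> {morph c : x y / x - y} ->
    (forall a x, c (a *: x) = a * c x) ->
    (forall i, c (e i) = 0) -> (forall i, c (f i) = 0) ->
    (forall i, c (k i) = 1) -> (forall i, c (kV i) = 1) ->
  forall u v, uq_rel u v -> c u = c v.
Proof.
move=> c1 cM cB cZ ce cf ck ckV u v.
have c0 : c 0 = 0 by rewrite -(subrr 1) cB subrr.
by case=> [i|i|i j|i j|i j|i j||||||||||];
  rewrite /qcomm !(cB, cM, cZ, c1, ce, cf, ck, ckV, c0)
    ?(mulr1, mul1r, mulr0, mul0r, subrr).
Qed.

End UqRelations.

Lemma uq_rel_morph (K : fieldType) (q : K) (A B : algType K)
    (phi : {lrmorphism A -> B}) (e f k kV : 'I_3 -> A) (u v : B) :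
  uq_rel q (phi \o e) (phi \o f) (phi \o k) (phi \o kV) u v ->
  exists u' v', [/\ uq_rel q e f k kV u' v', u = phi u' & v = phi v'].
Proof.
have p1 : phi 1 = 1 by exact: rmorph1.
have p0 : phi 0 = 0 by exact: rmorph0.
have pM x y : phi (x * y) = phi x * phi y by exact: rmorphM.
have pB x y : phi (x - y) = phi x - phi y by exact: rmorphB.
have pZ a x : phi (a *: x) = a *: phi x by exact: linearZ.
have W u1 v1 u' v' : uq_rel q e f k kV u' v' -> phi u' = u1 -> phi v' = v1 ->
    exists u2 v2, [/\ uq_rel q e f k kV u2 v2, u1 = phi u2 & v1 = phi v2].
  by move=> uv <- <-; exists u', v'.
case=> [i|i|i j|i j|i j|i j||||||||||].
- by apply: (W _ _ _ _ (@UqKKV K q A e f k kV i)); rewrite /qcomm ?(pB, pM, pZ, p1, p0).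
- by apply: (W _ _ _ _ (@UqKVK K q A e f k kV i)); rewrite /qcomm ?(pB, pM, pZ, p1, p0).
- by apply: (W _ _ _ _ (@UqKK K q A e f k kV i j)); rewrite /qcomm ?(pB, pM, pZ, p1, p0).
- by apply: (W _ _ _ _ (@UqKE K q A e f k kV i j)); rewrite /qcomm ?(pB, pM, pZ, p1, p0).
- by apply: (W _ _ _ _ (@UqKF K q A e f k kV i j)); rewrite /qcomm ?(pB, pM, pZ, p1, p0).
- by apply: (W _ _ _ _ (@UqEF K q A e f k kV i j)); rewrite /qcomm ?(pB, pM, pZ, p1, p0).
- by apply: (W _ _ _ _ (@UqE13 K q A e f k kV)); rewrite /qcomm ?(pB, pM, pZ, p1, p0).
- by apply: (W _ _ _ _ (@UqE12 K q A e f k kV)); rewrite /qcomm ?(pB, pM, pZ, p1, p0).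
- by apply: (W _ _ _ _ (@UqE21 K q A e f k kV)); rewrite /qcomm ?(pB, pM, pZ, p1, p0).
- by apply: (W _ _ _ _ (@UqE23 K q A e f k kV)); rewrite /qcomm ?(pB, pM, pZ, p1, p0).
- by apply: (W _ _ _ _ (@UqE32 K q A e f k kV)); rewrite /qcomm ?(pB, pM, pZ, p1, p0).
- by apply: (W _ _ _ _ (@UqF13 K q A e f k kV)); rewrite /qcomm ?(pB, pM, pZ, p1, p0).
- by apply: (W _ _ _ _ (@UqF12 K q A e f k kV)); rewrite /qcomm ?(pB, pM, pZ, p1, p0).
- by apply: (W _ _ _ _ (@UqF21 K q A e f k kV)); rewrite /qcomm ?(pB, pM, pZ, p1, p0).
- by apply: (W _ _ _ _ (@UqF23 K q A e f k kV)); rewrite /qcomm ?(pB, pM, pZ, p1, p0).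
- by apply: (W _ _ _ _ (@UqF32 K q A e f k kV)); rewrite /qcomm ?(pB, pM, pZ, p1, p0).
Qed.

Section Uq.
Variables (K : fieldType) (q : K).

Definition free_rel : free_alg K -> free_alg K -> Prop :=
  uq_rel q (fun i => free_gen K (GenE i)) (fun i => free_gen K (GenF i))
    (fun i => free_gen K (GenK i)) (fun i => free_gen K (GenKV i)).

(* The trivial representation e, f |-> 0, k |-> 1 shows that the relations do
   not collapse the algebra. *)
Definition gen_counit (g : gen) : K :=
  match g with GenE _ | GenF _ => 0 | GenK _ | GenKV _ => 1 end.

Definition word_counit (m : {fmonom gen}) : K := \prod_(g <- m) gen_counit g.

Fact word_counit_morph : mmorphism word_counit.
Proof.
rewrite /mmorphism; split; last by rewrite /word_counit fm1 big_nil.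
by move=> x y /=; rewrite /word_counit fmM big_cat.
Qed.
HB.instance Definition _ :=
  isMultiplicative.Build {fmonom gen} K word_counit word_counit_morph.

Definition free_counit (x : free_alg K) : K := mmap idfun word_counit x.

Fact free_counitM x y : free_counit (x * y) = free_counit x * free_counit y.
Proof. exact: (mmap_is_multiplicative (f := idfun) (h := word_counit)).1. Qed.
Fact free_counit1 : free_counit 1 = 1.
Proof. exact: (mmap_is_multiplicative (f := idfun) (h := word_counit)).2. Qed.
Fact free_counitB x y : free_counit (x - y) = free_counit x - free_counit y.
Proof. exact: (mmap_is_additive (f := idfun) (h := word_counit)). Qed.
Fact free_counitZ a x : free_counit (a *: x) = a * free_counit x.
Proof. exact: (mmapZ (f := idfun) (h := word_counit)). Qed.
Fact free_counit_gen g : free_counit (free_gen K g) = gen_counit g.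
Proof.
rewrite free_gen.unlock.
apply: etrans (mmapU (f := idfun) (h := word_counit) _ _) _.
by rewrite mul1r /word_counit fmU big_seq1.
Qed.

Fact uq_proper : 1 \notin ideal2_gen free_rel.
Proof.
have c0 : free_counit 0 = 0 by have := free_counitB 0 0; rewrite !subrr.
apply/negP => /ideal2_genP h.
suff : 1 \in [pred x | free_counit x == 0] by rewrite inE free_counit1 oner_eq0.
apply: h.
- split=> [|a x|a x].
  + split=> [|x y]; first by rewrite inE c0.
    by rewrite !inE free_counitB => /eqP-> /eqP->; rewrite subr0.
  + by rewrite !inE free_counitM => /eqP->; rewrite mulr0.
  + by rewrite !inE free_counitM => /eqP->; rewrite mul0r.
- move=> u v uv; rewrite inE free_counitB subr_eq0; apply/eqP.
  apply: (uq_rel_counit free_counit1 free_counitM free_counitB free_counitZ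
    _ _ _ _ uv) => i; exact: free_counit_gen.
Qed.

Definition Uq : Type := quot_alg uq_proper.
HB.instance Definition _ := GRing.Algebra.on Uq.

Definition uq_gen (g : gen) : Uq := to_quot_alg uq_proper (free_gen K g).

End Uq.

Section UqNotions.
Variables (K : fieldType) (q : K).
Local Notation U := (Uq q).

Definition uE (i : 'I_3) : U := uq_gen q (GenE i).
Definition uF (i : 'I_3) : U := uq_gen q (GenF i).
Definition uK (i : 'I_3) : U := uq_gen q (GenK i).   (* q^{h_i} *)
Definition uKV (i : 'I_3) : U := uq_gen q (GenKV i). (* q^{- h_i} *)

Lemma uq_relations u v : uq_rel q uE uF uK uKV u v -> u = v.
Proof.
case/(uq_rel_morph (phi := to_quot_alg (uq_proper q))) => u' [v' [uv -> ->]].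
by apply/to_quot_algE/ideal2_genP => S _; apply.
Qed.

Definition f_delta : U :=
  uF n2 ^+ 2 * uF n3 - (q ^+ 2 + q ^- 2) *: (uF n2 * uF n3 * uF n2)
  + uF n3 * uF n2 ^+ 2.

Definition f_xi : U :=
  qcomm (q ^- 2) (qcomm q^-1 (uF n1) (uF n2)) (uF n3).

Definition f_theta : U := qcomm q (uF n2) f_xi.

Record is_omega (omega : U -> U) : Prop := IsOmega {
  omega_linear : linear omega;
  omega1 : omega 1 = 1;
  omegaM : forall x y, omega (x * y) = omega y * omega x;
  omegaK : involutive omega;
  omega_uK : forall i, omega (uK i) = uK i;
  omega_uKV : forall i, omega (uKV i) = uKV i;
  omega_uE : forall i, omega (uE i) = - (uF i * uK i);
  omega_uF : forall i, omega (uF i) = - (uKV i * uE i)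
}.

(* U-modules are left modules over the ring U; scalars of K act through the
   unit K -> U. *)
Definition kscale (M : lmodType U) (a : K) (v : M) : M := (a%:A : U) *: v.

Record contravariant_form (omega : U -> U) (M : lmodType U)
    (B : M -> M -> K) : Prop := ContravariantForm {
  form_linear : forall a u v w, B (kscale a u + v) w = a * B u w + B v w;
  form_sym : forall v w, B v w = B w v;
  form_contra : forall x v w, B (x *: v) w = B v (omega x *: w)
}.

Definition linearly_independent (M : lmodType U) (I : eqType) (y : I -> M) :=
  forall (s : seq I) (a : I -> K), uniq s ->
    \sum_(t <- s) kscale (a t) (y t) = 0 -> forall t, t \in s -> a t = 0.

Definition spanning (M : lmodType U) (I : eqType) (y : I -> M) :=
  forall v : M, exists (s : seq I) (a : I -> K),
    v = \sum_(t <- s) kscale (a t) (y t).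

Definition orthonormal_basis (M : lmodType U) (B : M -> M -> K)
    (I : eqType) (y : I -> M) :=
  [/\ forall t u, B (y t) (y u) = (t == u)%:R,
      linearly_independent y & spanning y].

(* Highest weights are given through the eigenvalues wt i of q^{h_i}. *)
Variable wt : 'I_3 -> K.

Variant verma_rel : U^o -> Prop :=
| VermaE i : verma_rel (uE i)
| VermaK i : verma_rel (uK i - (wt i)%:A).

Definition verma : Type := quot_mod verma_rel.
HB.instance Definition _ := GRing.Lmodule.on verma.

Definition verma_vector : verma := to_quot_mod verma_rel (1 : U^o).

Variant base_rel : verma -> Prop :=
| BaseF1 : base_rel (uF n1 *: verma_vector)
| BaseF3 : base_rel (uF n3 *: verma_vector)
| BaseFdelta : base_rel (f_delta *: verma_vector).

Definition base_module : Type := quot_mod base_rel.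
HB.instance Definition _ := GRing.Lmodule.on base_module.

Definition base_vector : base_module := to_quot_mod base_rel verma_vector.

End UqNotions.

(** * Weights over the complex numbers *)

Section ComplexWeights.
Variable R : realType.

Definition cexp (z : R[i]) : R[i] :=
  (expR (complex.Re z) * cos (complex.Im z)
   +i* (expR (complex.Re z) * sin (complex.Im z)))%C.

(* q^x for the chosen logarithm hbar of q *)
Definition cpow (hbar x : R[i]) : R[i] := cexp (hbar * x).

Definition highest_weight (hbar : R[i]) (lam : 'rV[R[i]]_3) (i : 'I_3) : R[i] :=
  cpow hbar (pairing (simple_root R[i] i) lam).

End ComplexWeights.

(** * Normalizing factors *)

(* The sl(2)-norm of f^m on a vector v with e v = 0 and q^h v = q^l v, for
   m <= l. Since e f^s v = [s] [l - s + 1] f^(s-1) v and omega f = - q^(-h) e,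
   going from f^(s-1) v to f^s v multiplies the norm by
   - q^(- (l - 2 s + 2)) [s] [l - s + 1].
   The node n3 has root length (alpha_3, alpha_3) = 4, so that the same
   computation there involves q ^+ 2 in place of q, and a further factor
   [2]_q for each s. *)
Definition dnorm (K : fieldType) (q : K) (l m : nat) : K :=
  (-1) ^+ m * q ^- (m * (l - m).+1) *
  \prod_(1 <= s < m.+1) (qint q s * qint q (l - s).+1).

(* The quadruples (l, k, i, j) with i, j <= l *)
Definition yindex : Type := {l : nat & (nat * 'I_l.+1 * 'I_l.+1)%type}.
HB.instance Definition _ := Choice.on yindex.

Definition yfamily (T : Type) (y : nat -> nat -> nat -> nat -> T) (t : yindex) : T :=
  let: existT l (k, i, j) := t in y l k i j.

(* Main.v *)
(** Under the two commuting copies of U_q(sl(2)) generated by e_1, f_1 and by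
    e_3, f_3, the vectors u = f_2^l f_theta^k 1_lambda are highest vectors that
    generate modules of dimension (l + 1) x (l + 1).  Hence vectors
    f_1^i f_3^j u with different (i, j) are orthogonal by sl(2)-theory, those
    with equal (i, j) and different (l, k) because their weights differ, and
    the norms reduce to those of the vectors u.

    In U_q the element f_theta commutes with f_2, f_3, f_delta up to powers of
    q, and with f_1 up to terms in the left ideal generated by f_1 and f_delta;
    so every f_theta^k 1_lambda is killed by f_1, f_3 and f_delta, just as
    1_lambda is.  The Serre relations then express f_2 f_1^i f_3^j u with
    i, j <= 1 through the system, whose span is therefore a submodule.  In the
    same way e_2 u is a combination of f_2^(l-1) f_theta^k 1_lambda and of a
    vector orthogonal to it, which gives a recursion for the norms of the u.
    The condition q^(2(lambda, eps_2)) = - q^(-2) turns its factors into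
    products of q-integers and of numbers q^n + q^(-n), which do not vanish. *)
Require Import Defs.
From mathcomp Require Import all_boot all_order all_algebra.
From mathcomp Require Import complex reals exp trigo.
From mathcomp Require Import ring.
From mathcomp.multinomials Require Import monalg.

Set Implicit Arguments.
Unset Strict Implicit.
Unset Printing Implicit Defensive.

Import GRing.Theory.
Local Open Scope ring_scope.

(** * Normal forms of words acting on a vector *)

Section Normalizer.
Variables (K : fieldType) (A : algType K) (M : lmodType A).
Variables (env : seq A) (base : M).

(** Coefficients stay terms of [K], so that normalisation leaves only scalar equations, ready for
    [ring] and [field]. *)
Inductive aexp :=
  | AVar of nat | AZero | AOne | AAdd of aexp & aexp | AOpp of aexp
  | AMul of aexp & aexp | AScale of K & aexp.

Inductive vexp :=
  | VBase | VZero | VAdd of vexp & vexp | VOpp of vexp | VAct of aexp & vexp.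

Fixpoint aval (e : aexp) : A :=
  match e with
  | AVar n => nth 0 env n | AZero => 0 | AOne => 1
  | AAdd a b => aval a + aval b | AOpp a => - aval a
  | AMul a b => aval a * aval b | AScale c a => c *: aval a
  end.

Fixpoint vval (e : vexp) : M :=
  match e with
  | VBase => base | VZero => 0
  | VAdd a b => vval a + vval b | VOpp a => - vval a
  | VAct a v => aval a *: vval v
  end.

(* A pair (c, w) stands for the vector c w base, where the word w lists
   positions in env. *)
Definition lincomb := seq (K * seq nat).

Fixpoint word_val (w : seq nat) : M :=
  if w is n :: w' then nth 0 env n *: word_val w' else base.

Fixpoint lincomb_val (p : lincomb) : M :=
  if p is (c, w) :: p' then (c%:A : A) *: word_val w + lincomb_val p' else 0.

Fixpoint lincomb_scale (c : K) (p : lincomb) : lincomb :=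
  if p is (d, w) :: p' then (c * d, w) :: lincomb_scale c p' else [::].

Fixpoint lincomb_opp (p : lincomb) : lincomb :=
  if p is (d, w) :: p' then (- d, w) :: lincomb_opp p' else [::].

Fixpoint lincomb_bind (f : seq nat -> lincomb) (p : lincomb) : lincomb :=
  if p is (d, w) :: p' then lincomb_scale d (f w) ++ lincomb_bind f p'
  else [::].

(* Rewriting rules: an equation of operators applies anywhere in a word, an
   equation of vectors applies to the whole tail of a word. *)
Inductive rules :=
  | RNil | ROp of aexp & aexp | RVec of vexp & vexp | RCat of rules & rules.

Fixpoint rules_hold (r : rules) : Prop :=
  match r with
  | RNil => True
  | ROp a b => aval a = aval b
  | RVec u v => vval u = vval v
  | RCat r1 r2 => rules_hold r1 /\ rules_hold r2
  end.

(** Only a product of letters has a word; a rule whose left side has another form never fires. *)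
Fixpoint aexp_word (e : aexp) : option (seq nat) :=
  match e with
  | AVar n => Some [:: n]
  | AMul a b =>
      if aexp_word a is Some u then
        if aexp_word b is Some v then Some (u ++ v) else None
      else None
  | _ => None
  end.

Fixpoint vexp_word (e : vexp) : option (seq nat) :=
  match e with
  | VBase => Some [::]
  | VAct a v =>
      if aexp_word a is Some u then
        if vexp_word v is Some w then Some (u ++ w) else None
      else None
  | _ => None
  end.

Fixpoint strip_prefix (p w : seq nat) : option (seq nat) :=
  match p, w with
  | [::], _ => Some w
  | a :: p', b :: w' => if eqn a b then strip_prefix p' w' else None
  | _, [::] => None
  end.

Fixpoint find_rule (r : rules) (w : seq nat) :
    option (aexp * seq nat + vexp) :=
  match r with
  | RNil => None
  | ROp a b =>
      if aexp_word a is Some p then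
        if strip_prefix p w is Some w' then Some (inl (b, w')) else None
      else None
  | RVec u v =>
      if vexp_word u is Some p then
        if strip_prefix p w is Some [::] then Some (inr v) else None
      else None
  | RCat r1 r2 =>
      if find_rule r1 w is Some x then Some x else find_rule r2 w
  end.

Section Normal.
Variable push : nat -> seq nat -> lincomb.

Fixpoint act_normal (e : aexp) (p : lincomb) : lincomb :=
  match e with
  | AVar n => lincomb_bind (push n) p
  | AZero => [::]
  | AOne => p
  | AAdd a b => act_normal a p ++ act_normal b p
  | AOpp a => lincomb_opp (act_normal a p)
  | AMul a b => act_normal a (act_normal b p)
  | AScale c a => lincomb_scale c (act_normal a p)
  end.

Fixpoint vexp_normal (e : vexp) : lincomb :=
  match e with
  | VBase => [:: (1, [::])]
  | VZero => [::]
  | VAdd a b => vexp_normal a ++ vexp_normal b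
  | VOpp a => lincomb_opp (vexp_normal a)
  | VAct a v => act_normal a (vexp_normal v)
  end.

End Normal.

(** Letters are pushed one by one onto words that are already reduced, so a rule need only be sought
    at the head. When the fuel runs out the word is left as it is, which is still sound. *)
Fixpoint push_letter (r : rules) (fuel : nat) (n : nat) (w : seq nat) :
    lincomb :=
  if fuel is fuel'.+1 then
    match find_rule r (n :: w) with
    | None => [:: (1, n :: w)]
    | Some (inl (a, w')) => act_normal (push_letter r fuel') a [:: (1, w')]
    | Some (inr v) => vexp_normal (push_letter r fuel') v
    end
  else [:: (1, n :: w)].

Fixpoint eq_word (u v : seq nat) : bool :=
  match u, v with
  | [::], [::] => true
  | a :: u', b :: v' => if eqn a b then eq_word u' v' else false
  | _, _ => false
  end.

Fixpoint add_term (c : K) (w : seq nat) (p : lincomb) : lincomb :=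
  if p is (d, v) :: p' then
    if eq_word w v then (c + d, v) :: p' else (d, v) :: add_term c w p'
  else [:: (c, w)].

Fixpoint collect (p : lincomb) : lincomb :=
  if p is (c, w) :: p' then add_term c w (collect p') else [::].

Fixpoint all_zero (p : lincomb) : Prop :=
  if p is (c, _) :: p' then c = 0 /\ all_zero p' else True.

Lemma scalar_act_comm (c : K) (a : A) (v : M) :
  a *: ((c%:A : A) *: v) = (c%:A : A) *: (a *: v).
Proof. by rewrite !scalerA -scalerAl -scalerAr mul1r mulr1. Qed.

Lemma lincomb_val_cat p1 p2 :
  lincomb_val (p1 ++ p2) = lincomb_val p1 + lincomb_val p2.
Proof. by elim: p1 => [|[c w] p IH] /=; rewrite ?add0r // IH addrA. Qed.

Lemma lincomb_val_scale c p :
  lincomb_val (lincomb_scale c p) = (c%:A : A) *: lincomb_val p.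
Proof.
elim: p => [|[d w] p IH] /=; first by rewrite scaler0.
by rewrite IH scalerDr scalerA -scalerAl mul1r scalerA.
Qed.

Lemma lincomb_val_opp p : lincomb_val (lincomb_opp p) = - lincomb_val p.
Proof.
elim: p => [|[d w] p IH] /=; first by rewrite oppr0.
by rewrite IH opprD scaleNr scaleNr.
Qed.

Lemma lincomb_val_bind f (a : A) p :
    (forall w, lincomb_val (f w) = a *: word_val w) ->
  lincomb_val (lincomb_bind f p) = a *: lincomb_val p.
Proof.
move=> fP; elim: p => [|[d w] p IH] /=; first by rewrite scaler0.
by rewrite lincomb_val_cat lincomb_val_scale fP IH scalerDr scalar_act_comm.
Qed.

Section NormalCorrect.
Variable push : nat -> seq nat -> lincomb.
Hypothesis pushP : forall n w,
  lincomb_val (push n w) = nth 0 env n *: word_val w.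

Lemma act_normalP e p :
  lincomb_val (act_normal push e p) = aval e *: lincomb_val p.
Proof.
elim: e p => [n|||a IHa b IHb|a IHa|a IHa b IHb|c a IHa] p /=.
- exact: lincomb_val_bind.
- by rewrite scale0r.
- by rewrite scale1r.
- by rewrite lincomb_val_cat IHa IHb scalerDl.
- by rewrite lincomb_val_opp IHa scaleNr.
- by rewrite IHa IHb scalerA.
- by rewrite lincomb_val_scale IHa scalerA -scalerAl mul1r.
Qed.

Lemma vexp_normalP e : lincomb_val (vexp_normal push e) = vval e.
Proof.
elim: e => [||a IHa b IHb|a IHa|a v IHv] //=.
- by rewrite !scale1r addr0.
- by rewrite lincomb_val_cat IHa IHb.
- by rewrite lincomb_val_opp IHa.
- by rewrite act_normalP IHv.
Qed.

End NormalCorrect.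

Lemma word_val_cat_aexp e u w :
  aexp_word e = Some u -> word_val (u ++ w) = aval e *: word_val w.
Proof.
elim: e u w => [n|||||a IHa b IHb|] //= u w; first by case=> <-.
case: (aexp_word a) IHa => // u1 IHa; case: (aexp_word b) IHb => // u2 IHb.
by case=> <-; rewrite -catA (IHa u1) // (IHb u2) // scalerA.
Qed.

Lemma word_val_vexp e u : vexp_word e = Some u -> word_val u = vval e.
Proof.
elim: e u => [||||a v IH] //= u; first by case=> <-.
case: (aexp_word a) (@word_val_cat_aexp a) => // u1 ua.
case: (vexp_word v) IH => // u2 IH.
by case=> <-; rewrite (ua u1) // IH.
Qed.

Lemma strip_prefixP p w w' : strip_prefix p w = Some w' -> w = p ++ w'.
Proof.
elim: p w => [|a p IH] [|b w] //=; do ?by case.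
by case: eqnP => // <- /IH ->.
Qed.

Lemma find_ruleP r w x : rules_hold r -> find_rule r w = Some x ->
  word_val w = match x with
    inl (a, w') => aval a *: word_val w' | inr v => vval v end.
Proof.
elim: r x => [//|a b|u v|r1 IH1 r2 IH2] x /=.
- case: (aexp_word a) (@word_val_cat_aexp a) => // p ap ab.
  case E: (strip_prefix p w) => [w'|] // [<-].
  by rewrite (strip_prefixP E) (ap p) // ab.
- case: (vexp_word u) (@word_val_vexp u) => // p up uv.
  case E: (strip_prefix p w) => [[|//]|] // [<-].
  by rewrite (strip_prefixP E) cats0 (up p).
- case=> /IH1 {}IH1 /IH2 {}IH2.
  by case: (find_rule r1 w) IH1 => [y|] IH1; [case=> <-; apply: IH1|exact: IH2].
Qed.

Lemma push_letterP r fuel : rules_hold r -> forall n w,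
  lincomb_val (push_letter r fuel n w) = nth 0 env n *: word_val w.
Proof.
move=> rP; elim: fuel => [|fuel IH] n w /=; first by rewrite !scale1r addr0.
case E: (find_rule r (n :: w)) => [[[a w']|v]|] /=.
- by rewrite act_normalP //= !scale1r addr0; apply/esym/(find_ruleP rP E).
- by rewrite vexp_normalP //; apply/esym/(find_ruleP rP E).
- by rewrite !scale1r addr0.
Qed.

Lemma eq_wordP u v : eq_word u v -> u = v.
Proof. by elim: u v => [|a u IH] [|b v] //=; case: eqnP => // <- /IH ->. Qed.

Lemma add_termP c w p :
  lincomb_val (add_term c w p) = (c%:A : A) *: word_val w + lincomb_val p.
Proof.
elim: p => [|[d v] p IH] //=.
case E: (eq_word w v) => /=; last by rewrite IH addrCA.
by rewrite (eq_wordP E) !scalerDl addrA.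
Qed.

Lemma collectP p : lincomb_val (collect p) = lincomb_val p.
Proof. by elim: p => [|[c w] p IH] //=; rewrite add_termP IH. Qed.

Lemma all_zeroP p : all_zero p -> lincomb_val p = 0.
Proof.
by elim: p => [|[c w] p IH] //= [-> /IH ->]; rewrite !scale0r addr0.
Qed.

(** The vanishing of all collected coefficients is a sufficient condition only: words may be
    dependent, and soundness of each rewriting step is enough, without confluence or termination. *)
Lemma normalize_eq r fuel u v : rules_hold r ->
    all_zero (collect (vexp_normal (push_letter r fuel) (VAdd u (VOpp v)))) ->
  vval u = vval v.
Proof.
move=> rP /all_zeroP; rewrite collectP vexp_normalP; last exact: push_letterP.
by move/eqP; rewrite subr_eq0 => /eqP.
Qed.

End Normalizer.

(** An identity of operators is tested on the unit of the regular module, so that one normaliser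
    serves operators and vectors alike. *)
Lemma regular_eq (K : fieldType) (A : algType K) (a b : A) :
  a *: (1 : A^o) = b *: (1 : A^o) -> a = b.
Proof. by rewrite /GRing.scale /= !mulr1. Qed.

(** * Reification of identities and rewriting rules *)

Ltac nc_index x l :=
  lazymatch l with
  | nil => fail "unknown letter" x
  | cons x _ => constr:(O)
  | cons _ ?l' => let n := nc_index x l' in constr:(S n)
  end.

Ltac nc_aexp K l t :=
  lazymatch t with
  | @Algebra.zero _ => constr:(@AZero K)
  | @GRing.one _ => constr:(@AOne K)
  | @Algebra.add _ ?a ?b =>
      let a' := nc_aexp K l a in let b' := nc_aexp K l b in
      constr:(@AAdd K a' b')
  | @Algebra.opp _ ?a => let a' := nc_aexp K l a in constr:(@AOpp K a')
  | @GRing.mul _ ?a ?b =>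
      let a' := nc_aexp K l a in let b' := nc_aexp K l b in
      constr:(@AMul K a' b')
  | @GRing.scale _ _ ?c ?a =>
      let a' := nc_aexp K l a in constr:(@AScale K c a')
  | @GRing.exp _ ?a 2 =>
      let a' := nc_aexp K l a in constr:(@AMul K a' a')
  | _ => let n := nc_index t l in constr:(@AVar K n)
  end.

Ltac nc_vexp K l v t :=
  lazymatch t with
  | v => constr:(@VBase K)
  | @Algebra.zero _ => constr:(@VZero K)
  | @Algebra.add _ ?a ?b =>
      let a' := nc_vexp K l v a in let b' := nc_vexp K l v b in
      constr:(@VAdd K a' b')
  | @Algebra.opp _ ?a => let a' := nc_vexp K l v a in constr:(@VOpp K a')
  | @GRing.scale _ _ ?a ?u =>
      let a' := nc_aexp K l a in let u' := nc_vexp K l v u in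
      constr:(@VAct K a' u')
  end.

Ltac nc_rules K A l v rs :=
  lazymatch rs with
  | tt => constr:(@RNil K)
  | (?r1, ?r2) =>
      let r1' := nc_rules K A l v r1 in let r2' := nc_rules K A l v r2 in
      constr:(@RCat K r1' r2')
  | _ =>
      let T := type of rs in
      let T := eval cbv beta in T in
      lazymatch T with
      | @eq ?B ?a ?b =>
          (* The dummy scrutinee gives a choice point: an equation outside [A] fails in the first
             branch and is read as one of vectors in the second. *)
          match constr:(Set) with
          | _ =>
              let _ := constr:(erefl : B = A :> Type) in
              let a' := nc_aexp K l a in let b' := nc_aexp K l b in
              constr:(@ROp K a' b')
          | _ =>
              let a' := nc_vexp K l v a in let b' := nc_vexp K l v b in
              constr:(@RVec K a' b')
          end
      end
  end.

Ltac nc_proofs rs :=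
  lazymatch rs with
  | tt => constr:(I)
  | (?r1, ?r2) =>
      let p1 := nc_proofs r1 in let p2 := nc_proofs r2 in constr:(conj p1 p2)
  | _ => rs
  end.

Ltac nc_compute :=
  cbv [collect vexp_normal act_normal push_letter find_rule strip_prefix
    aexp_word vexp_word lincomb_scale lincomb_opp lincomb_bind add_term
    eq_word all_zero eqn cat].

(* Proves an equation of vectors by reducing both sides to combinations of words
   in the letters l applied to v, using the equations rs as rewriting rules;
   leaves one equation of scalars for each word. *)
Ltac ncv K A l v rs :=
  lazymatch goal with
  | |- @eq _ ?a ?b =>
      let a' := nc_vexp K l v a in let b' := nc_vexp K l v b in
      let r := nc_rules K A l v rs in
      let p := nc_proofs rs in
      refine (@normalize_eq K _ _ l v r 40%N a' b' p _);
      nc_compute; repeat (split; [|]); try exact I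
  end.

(** * Identities in the quantized enveloping algebra *)

Lemma root_pairingE (i j : 'I_3) : root_pairing i j =
  nth 0 (nth [::] [:: [:: 2; -1; 0]; [:: -1; 2; -2]; [:: 0; -2; 4]] i) j
    :> int.
Proof.
rewrite /root_pairing /pairing !big_ord_recl big_ord0.
by case: i => [[|[|[|//]]] ?]; case: j => [[|[|[|//]]] ?];
  rewrite /simple_root /eps !mxE.
Qed.

(* A is any algebra with the relations of U_q: the quotient Uq q is transparent,
   and unification is slow there. *)
Section Relations.
Variables (K : fieldType) (q : K).
Hypothesis q0 : q != 0.
Hypothesis qP : forall n, (0 < n)%N -> q ^+ n != 1.
Variables (A : algType K) (e f k kV : 'I_3 -> A).
Hypothesis relP : forall u v, uq_rel q e f k kV u v -> u = v.
Local Notation e1 := (e n1).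
Local Notation e2 := (e n2).
Local Notation e3 := (e n3).
Local Notation f1 := (f n1).
Local Notation f2 := (f n2).
Local Notation f3 := (f n3).
Local Notation k1 := (k n1).
Local Notation k2 := (k n2).
Local Notation k3 := (k n3).
Local Notation kV1 := (kV n1).
Local Notation kV2 := (kV n2).
Local Notation kV3 := (kV n3).

Ltac nz :=
  repeat (apply/andP; split); try assumption; try exact: isT;
  try exact: oner_neq0;
  match goal with
  | H : is_true (?y != 0) |- is_true (?x != 0) =>
      let E := fresh in (have E : x = y by ring); rewrite E; exact: H
  end.
Ltac nfield := field; nz.
Ltac nc l rs := apply: regular_eq; ncv K A l (1 : A^o) rs.

Lemma k_kV i : k i * kV i = 1.
Proof. exact: relP (UqKKV _ _ _ _ _ _). Qed.

Lemma kV_k i : kV i * k i = 1.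
Proof. exact: relP (UqKVK _ _ _ _ _ _). Qed.

Lemma k_f i j : k i * f j = q ^ (- root_pairing i j) *: (f j * k i).
Proof. exact: relP (UqKF _ _ _ _ _ _ _). Qed.

Lemma kV_f i j : kV i * f j = q ^ (root_pairing i j) *: (f j * kV i).
Proof.
have /(congr1 (fun x => kV i * x * kV i)) := k_f i j.
rewrite !mulrA kV_k mul1r -scalerAr -scalerAl mulrA -!mulrA k_kV mulr1.
by move=> ->; rewrite scalerA -expfzDr // subrr expr0z scale1r.
Qed.

Lemma e_f i : e i * f i = f i * e i + (q - q^-1)^-1 *: (k i - kV i).
Proof.
have := relP (UqEF q e f k kV i i).
by rewrite eqxx scale1r /qcomm scale1r => <-; rewrite addrC subrK.
Qed.

Lemma e_f_neq i j : i != j -> e i * f j = f j * e i.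
Proof.
move=> ij; have := relP (UqEF q e f k kV i j).
by rewrite (negPf ij) scale0r /qcomm scale1r => /eqP; rewrite subr_eq0 => /eqP.
Qed.

Lemma f13 : f1 * f3 = f3 * f1.
Proof.
have := relP (UqF13 q e f k kV).
by rewrite /qcomm scale1r => /eqP; rewrite subr_eq0 => /eqP.
Qed.

Lemma serre12 : f1 * f1 * f2 = (q + q^-1) *: (f1 * f2 * f1) - f2 * f1 * f1.
Proof.
have h := relP (UqF12 q e f k kV).
apply/eqP; rewrite -subr_eq0 -[X in _ == X]h /qcomm; apply/eqP.
by nc [:: f1; f2] tt; field.
Qed.

Lemma serre21 : f1 * f2 * f2 = (q + q^-1) *: (f2 * f1 * f2) - f2 * f2 * f1.
Proof.
have h := relP (UqF21 q e f k kV).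
apply/eqP; rewrite -subr_eq0 -[X in _ == X]h /qcomm; apply/eqP.
by nc [:: f1; f2] tt; field.
Qed.

(** The repeated coefficient is [3]_q. The relation is kept as a vanishing element rather than as a
    rewriting rule, so that multiples of it can be combined below. *)
Let sum23 : A := f2 * f2 * f2 * f3
  - (q ^+ 2 + 1 + q ^- 2) *: (f2 * f2 * f3 * f2)
  + (q ^+ 2 + 1 + q ^- 2) *: (f2 * f3 * f2 * f2) - f3 * f2 * f2 * f2.

Lemma serre23 : sum23 = 0.
Proof.
have h := relP (UqF23 q e f k kV).
rewrite -[RHS]h /sum23 /qcomm.
by nc [:: f2; f3] tt; field.
Qed.

Lemma serre32 : f3 * f3 * f2 = (q ^+ 2 + q ^- 2) *: (f3 * f2 * f3) - f2 * f3 * f3.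
Proof.
have h := relP (UqF32 q e f k kV).
apply/eqP; rewrite -subr_eq0 -[X in _ == X]h /qcomm; apply/eqP.
by nc [:: f2; f3] tt; field.
Qed.

(** * Root vectors and their commutation rules with f_theta *)

Definition fx : A := qcomm q^-1 f1 f2.
Definition fxi : A := qcomm (q ^- 2) fx f3.
Definition fth : A := qcomm q f2 fxi.
Definition fde : A :=
  f2 ^+ 2 * f3 - (q ^+ 2 + q ^- 2) *: (f2 * f3 * f2) + f3 * f2 ^+ 2.

(* nz finds these facts in the context when field leaves side conditions. *)
Let qs0 : q ^+ 2 - 1 != 0. Proof. by rewrite subr_eq0 qP. Qed.
Let factor_neq0 n (x y : K) :
  (0 < n)%N -> q ^+ n - 1 = x * y -> x != 0.
Proof.
move=> n0 E; apply/eqP => x0; have /eqP[] := qP n0; apply/eqP.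
by rewrite -subr_eq0 E x0 mul0r.
Qed.
Let q20 : q ^+ 2 + 1 != 0.
Proof. by apply: (@factor_neq0 4 _ (q ^+ 2 - 1)) => //; ring. Qed.
Let q40 : q ^+ 4 + 1 != 0.
Proof. by apply: (@factor_neq0 8 _ (q ^+ 4 - 1)) => //; ring. Qed.
Let q420 : q ^+ 4 + q ^+ 2 + 1 != 0.
Proof. by apply: (@factor_neq0 6 _ (q ^+ 2 - 1)) => //; ring. Qed.

(** The commutator is the cubic Serre expression [sum23] itself. *)
Lemma f2_fde : f2 * fde = fde * f2.
Proof.
apply/eqP; rewrite -subr_eq0 -[X in _ == X]serre23 /sum23 /fde; apply/eqP.
by nc [:: f2; f3] tt; field.
Qed.

(* In the free algebra the difference of both sides is a combination of
   multiples of the Serre relations; the coefficients in S0 solve the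
   resulting linear system.  The same holds in f3_fth and fx_fth. *)
Lemma f2_fth : f2 * fth = q^-1 *: (fth * f2).
Proof.
have S0 : (q ^+ 2 + 1 + q ^- 2)^-1 *:
    (f1 * sum23 - q ^- 3 *: (sum23 * f1)) = 0.
  by rewrite serre23 mulr0 mul0r scaler0 subr0 scaler0.
apply/eqP; rewrite -subr_eq0 -[X in _ == X]S0; apply/eqP.
rewrite /sum23 /fth /fxi /fx /qcomm.
by nc [:: f1; f2; f3] (f13, serre21); nfield.
Qed.

Let sum32 : A := f3 * f3 * f2 - (q ^+ 2 + q ^- 2) *: (f3 * f2 * f3)
  + f2 * f3 * f3.

Lemma f3_fth : f3 * fth = fth * f3.
Proof.
have s32 : sum32 = 0 by rewrite /sum32 serre32; nc [:: f2; f3] tt; ring.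
have S0 : (q ^+ 2 + q ^- 2)^-1 *:
    (q *: (f1 * sum32 * f2 - f1 * f2 * sum32)
     + (1 - q ^- 2) *: (f2 * f1 * sum32 - sum32 * f1 * f2)
     + q ^- 3 *: (f2 * sum32 * f1 - sum32 * f2 * f1)) = 0.
  by rewrite s32 !(mulr0, mul0r) !subr0 !scaler0 !addr0 scaler0.
apply/eqP; rewrite -subr_eq0 -[X in _ == X]S0; apply/eqP.
rewrite /sum32 /fth /fxi /fx /qcomm.
by nc [:: f1; f2; f3] (f13, serre21); nfield.
Qed.

(** Every correction term ends in [fde] or [f1], so it kills each vector killed by both; this
    carries the induction in [f_wv]. *)
Lemma f1_fth : f1 * fth = fth * f1 + (q + q^-1)^-1 *:
  (f1 * f1 * fde - (1 + q ^- 2) *: (f1 * fde * f1) + q ^- 2 *: (fde * f1 * f1)).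
Proof.
rewrite /fde /fth /fxi /fx /qcomm.
by nc [:: f1; f2; f3] (f13, (serre12, serre21)); nfield.
Qed.

Lemma fx_fth : fx * fth = q *: (fth * fx).
Proof.
have S0 : (q ^+ 2 + 1 + q ^- 2)^-1 *:
    ((q / (q + q^-1)) *: (f1 * f1 * sum23) - q^-1 *: (f1 * sum23 * f1)
     + (q ^- 3 / (q + q^-1)) *: (sum23 * f1 * f1)) = 0.
  by rewrite serre23 !(mulr0, mul0r) !scaler0 subr0 addr0 scaler0.
apply/eqP; rewrite -subr_eq0 -[X in _ == X]S0; apply/eqP.
rewrite /sum23 /fth /fxi /fx /qcomm.
by nc [:: f1; f2; f3] (f13, (serre12, serre21)); nfield.
Qed.

Lemma fxi_fth : fxi * fth = q *: (fth * fxi).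
Proof.
rewrite /fxi /qcomm; nc [:: fx; fth; f3] (f3_fth, fx_fth); ring.
Qed.

(** The powers q^(-(alpha_i, alpha_j)) written with natural exponents and inverses, on which [ring]
    and [field] can compute. *)
Definition weight_factor (i j : 'I_3) : K :=
  nth 0 (nth [::] [:: [:: q ^- 2; q; 1]; [:: q; q ^- 2; q ^+ 2];
                      [:: 1; q ^+ 2; q ^- 4]] i) j.

Lemma weight_factorE i j : q ^ (- root_pairing i j) = weight_factor i j.
Proof.
rewrite root_pairingE /weight_factor.
by case: i => [[|[|[|//]]] ?]; case: j => [[|[|[|//]]] ?].
Qed.

Lemma weight_factor_neq0 i j : weight_factor i j != 0.
Proof. by rewrite -weight_factorE expfz_neq0. Qed.

Lemma k_f_weight i j : k i * f j = weight_factor i j *: (f j * k i).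
Proof. by rewrite k_f weight_factorE. Qed.

Lemma kV_f_weight i j : kV i * f j = (weight_factor i j)^-1 *: (f j * kV i).
Proof. by rewrite kV_f -weight_factorE invr_expz opprK. Qed.

(** The types spell out the table entries, equal by conversion, so that the rewriting rules carry
    explicit powers of q. *)
Let k1f1 : k1 * f1 = q ^- 2 *: (f1 * k1) := k_f_weight n1 n1.
Let k1f2 : k1 * f2 = q *: (f2 * k1) := k_f_weight n1 n2.
Let k1f3 : k1 * f3 = 1 *: (f3 * k1) := k_f_weight n1 n3.
Let k2f1 : k2 * f1 = q *: (f1 * k2) := k_f_weight n2 n1.
Let k2f2 : k2 * f2 = q ^- 2 *: (f2 * k2) := k_f_weight n2 n2.
Let k2f3 : k2 * f3 = q ^+ 2 *: (f3 * k2) := k_f_weight n2 n3.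
Let k3f1 : k3 * f1 = 1 *: (f1 * k3) := k_f_weight n3 n1.
Let k3f2 : k3 * f2 = q ^+ 2 *: (f2 * k3) := k_f_weight n3 n2.
Let k3f3 : k3 * f3 = q ^- 4 *: (f3 * k3) := k_f_weight n3 n3.
Let h1f2 : kV1 * f2 = q^-1 *: (f2 * kV1) := kV_f_weight n1 n2.
Let h1f3 : kV1 * f3 = 1^-1 *: (f3 * kV1) := kV_f_weight n1 n3.
Let h2f1 : kV2 * f1 = q^-1 *: (f1 * kV2) := kV_f_weight n2 n1.
Let h2f2 : kV2 * f2 = (q ^- 2)^-1 *: (f2 * kV2) := kV_f_weight n2 n2.
Let h2f3 : kV2 * f3 = (q ^+ 2)^-1 *: (f3 * kV2) := kV_f_weight n2 n3.
Let h3f1 : kV3 * f1 = 1^-1 *: (f1 * kV3) := kV_f_weight n3 n1.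
Let h3f2 : kV3 * f2 = (q ^+ 2)^-1 *: (f2 * kV3) := kV_f_weight n3 n2.

(** On a weight vector killed by e_1 and f_delta both terms on the right vanish, so applying f_theta
    keeps it highest for node [n1]. *)
Lemma e1_fth : e1 * fth = fth * e1 + fde * k1.
Proof.
rewrite /fth /fde /fxi /fx /qcomm.
nc [:: e1; f1; f2; f3; k1; kV1] (f13, (e_f n1,
  (e_f_neq (isT : n1 != n2), (e_f_neq (isT : n1 != n3),
  ((k1f2, k1f3), (h1f2, h1f3)))))); by nfield.
Qed.

Lemma e2_fth : e2 * fth = fth * e2 + fxi * kV2.
Proof.
rewrite /fth /fxi /fx /qcomm.
nc [:: e2; f1; f2; f3; k2; kV2] (f13, (e_f n2,
  (e_f_neq (isT : n2 != n1), (e_f_neq (isT : n2 != n3),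
  ((k2f1, (k2f2, k2f3)), (h2f1, (h2f2, h2f3))))))); by nfield.
Qed.

Lemma e3_fth : e3 * fth = fth * e3.
Proof.
rewrite /fth /fxi /fx /qcomm.
nc [:: e3; f1; f2; f3; k3; kV3] (f13, (e_f n3, (serre21,
  (e_f_neq (isT : n3 != n1), (e_f_neq (isT : n3 != n2),
  ((k3f1, k3f2), (h3f1, h3f2))))))); by nfield.
Qed.

Lemma k1_fth : k1 * fth = fth * k1.
Proof.
rewrite /fth /fxi /fx /qcomm.
nc [:: k1; f1; f2; f3] (k1f1, (k1f2, k1f3)); by nfield.
Qed.

Lemma k2_fth : k2 * fth = q^-1 *: (fth * k2).
Proof.
rewrite /fth /fxi /fx /qcomm.
nc [:: k2; f1; f2; f3] (k2f1, (k2f2, k2f3)); by nfield.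
Qed.

Lemma k3_fth : k3 * fth = fth * k3.
Proof.
rewrite /fth /fxi /fx /qcomm.
nc [:: k3; f1; f2; f3] (k3f1, (k3f2, k3f3)); by nfield.
Qed.

Lemma fde_fth : fde * fth = q ^- 2 *: (fth * fde).
Proof. rewrite /fde; nc [:: fth; f2; f3] (f2_fth, f3_fth); by nfield. Qed.

(** * Highest vectors for the nodes n1 and n3 *)

Section Module.
(** [z] is the eigenvalue of q^(h_2) on the highest vector; the base weight determines only its
    square. *)
Variables (M : lmodType A) (v0 : M) (z : K).
Hypothesis z2 : z ^+ 2 = - q ^- 2.
Hypothesis e_v0 : forall i, e i *: v0 = 0.
Local Notation "c *:: v" := ((c%:A : A) *: v) (at level 40).
Hypotheses (k1_v0 : k1 *: v0 = 1 *:: v0) (k2_v0 : k2 *: v0 = z *:: v0).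
Hypothesis k3_v0 : k3 *: v0 = 1 *:: v0.
Hypotheses (f1_v0 : f1 *: v0 = 0) (f3_v0 : f3 *: v0 = 0).
Hypothesis fde_v0 : fde *: v0 = 0.

Lemma scalarDl (a b : K) (v : M) : a *:: v + b *:: v = (a + b) *:: v.
Proof. by rewrite -scalerDl -scalerDl. Qed.

Lemma scalarA (a b : K) (v : M) : a *:: (b *:: v) = (a * b) *:: v.
Proof. by rewrite scalerA -scalerAl mul1r scalerA. Qed.

Lemma k_f_act i j c (v : M) : k i *: v = c *:: v ->
  k i *: (f j *: v) = (weight_factor i j * c) *:: (f j *: v).
Proof.
move=> kv; ncv K A [:: k i; f j] v (k_f_weight i j, kv); ring.
Qed.

Lemma k_f_pow_act i j c (v : M) n : k i *: v = c *:: v ->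
  k i *: (f j ^+ n *: v) = (weight_factor i j ^+ n * c) *:: (f j ^+ n *: v).
Proof.
move=> kv; elim: n => [|n IH]; first by rewrite !expr0 !scale1r mul1r.
rewrite exprS -scalerA (k_f_act j IH) mulrA.
by rewrite (exprS (weight_factor i j) n).
Qed.

Lemma kV_act i c (v : M) : c != 0 -> k i *: v = c *:: v ->
  kV i *: v = c^-1 *:: v.
Proof.
move=> c0 kv; have : kV i *: (k i *: v) = v by rewrite scalerA kV_k scale1r.
rewrite kv => {2}<-; rewrite scalar_act_comm scalarA mulVf //.
by rewrite scale1r scale1r.
Qed.

Lemma e_f_act i c (v : M) : c != 0 -> k i *: v = c *:: v ->
  e i *: (f i *: v) = f i *: (e i *: v) + ((c - c^-1) / (q - q^-1)) *:: v.
Proof.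
move=> c0 kv; have hv := kV_act c0 kv; have ev : e i *: v = e i *: v by [].
ncv K A [:: e i; f i; k i; kV i] v (e_f i, (kv, hv)); by nfield.
Qed.

Lemma k_f_pow_self i (p c : K) (v : M) s : weight_factor i i = p ^- 2 ->
  k i *: v = c *:: v ->
  k i *: (f i ^+ s *: v) = (c / (p ^+ s) ^+ 2) *:: (f i ^+ s *: v).
Proof.
by move=> pP kv; rewrite (k_f_pow_act i s kv) pP mulrC exprVn exprAC.
Qed.

(** Here p = q^((alpha_i, alpha_i)/2), that is q for [n1] and q^2 for [n3]. The q-integer is one in
    p, while the denominator q - q^-1 comes from the relation of e_i and f_i and is the same for all
    nodes. *)
Lemma e_f_pow_act i (p c : K) (v : M) s :
    p != 0 -> p ^+ 2 - 1 != 0 -> weight_factor i i = p ^- 2 ->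
    c != 0 -> k i *: v = c *:: v -> e i *: v = 0 ->
  e i *: (f i ^+ s.+1 *: v) =
    (qint p s.+1 * ((c / p ^+ s - p ^+ s / c) / (q - q^-1))) *:: (f i ^+ s *: v).
Proof.
move=> p0 p1 pP c0 kv ev; elim: s => [|s IH].
  rewrite exprS expr0 mulr1 (e_f_act c0 kv) ev scaler0 add0r scale1r.
  by congr (_%:A *: _); rewrite /qint; nfield.
have x0 : p ^+ s != 0 by rewrite expf_neq0.
rewrite exprS -scalerA (e_f_act _ (k_f_pow_self s.+1 pP kv)); last first.
  by rewrite mulf_neq0 // invr_eq0 !expf_neq0.
rewrite IH scalar_act_comm (scalerA (f i)) -exprS scalarDl.
congr (_%:A *: _); rewrite /qint !exprS.
move: (p ^+ s) x0 => x x0; nfield.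
Qed.

Lemma serre_pow_kill (a b : A) (c : K) (v : M) n :
    a * a * b = c *: (a * b * a) - b * a * a ->
  a ^+ n *: v = 0 -> a ^+ n.+1 *: (b *: v) = 0.
Proof.
(* The Serre relation leaves powers of [a] lowered by one and by two on the left of [b], so the
   induction carries two consecutive exponents. *)
move=> ab; suff [] : (forall v : M, a ^+ n *: v = 0 -> a ^+ n.+1 *: (b *: v) = 0) /\
  (forall v : M, a ^+ n.+1 *: v = 0 -> a ^+ n.+2 *: (b *: v) = 0) by auto.
elim: n {v} => [|n [IH1 IH2]]; split=> // v.
- by rewrite scale1r => ->; rewrite !scaler0.
- by rewrite expr1 => av; ncv K A [:: a; b] v (ab, av).
- have -> : a ^+ n.+3 *: (b *: v) =
      c *:: (a ^+ n.+2 *: (b *: (a *: v))) - a ^+ n.+1 *: (b *: (a *: (a *: v))).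
    by rewrite !(exprSr a n.+1) (exprSr a n.+2) (exprSr a n.+1);
      ncv K A [:: a; b; a ^+ n.+1] v ab; ring.
  move=> av; rewrite IH2 ?scaler0; last by rewrite scalerA -exprSr.
  by rewrite IH1 ?subrr // !scalerA -!exprSr.
Qed.

(** Used for relations that have no convenient orientation as rewriting rules. *)
Lemma eq_of_relation (c : K) (L R u v : M) :
  L = R -> u - v = c *:: (L - R) -> u = v.
Proof.
by move=> ->; rewrite subrr scaler0 => /eqP; rewrite subr_eq0 => /eqP.
Qed.

Lemma scalar_inj (c : K) (u v : M) : c != 0 -> c *:: u = c *:: v -> u = v.
Proof.
by move=> c0 /(congr1 (fun x => c^-1 *:: x)); rewrite !scalarA mulVf // !scale1r.
Qed.

Lemma qint_den (p : K) n :
  p != 0 -> qint p n.+1 != 0 -> (p * p ^+ n) ^+ 2 - 1 != 0.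
Proof.
move=> p0; rewrite /qint -exprS; have : p ^+ n.+1 != 0 by rewrite expf_neq0.
move: (p ^+ n.+1) => x x0; apply: contra => /eqP h.
have -> : x - x^-1 = (x ^+ 2 - 1) / x by nfield.
by rewrite h !mul0r.
Qed.

(** If r_l is the ratio, the relation gives r_(l+1) = 1 / ([2]_p - r_l), solved by means of [2][l+1]
    = [l+2] + [l]. It is required only on the vectors b^l v, since for f_3 it is the vanishing of
    f_delta on them. *)
Lemma serre_string (p : K) (a b : A) (v : M) l :
    p != 0 -> p ^+ 2 - 1 != 0 -> (forall n, qint p n.+1 != 0) ->
    a *: v = 0 ->
    (forall l, (b * b * a) *: (b ^+ l *: v) =
       (p + p^-1) *:: ((b * a * b) *: (b ^+ l *: v)) -
       (a * b * b) *: (b ^+ l *: v)) ->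
  b *: (a *: (b ^+ l *: v)) =
    (qint p l / qint p l.+1) *:: (a *: (b *: (b ^+ l *: v))).
Proof.
move=> p0 p1 pn av rec; elim: l => [|l IH].
  by rewrite expr0 scale1r av scaler0 /qint !expr0 invr1 subrr !mul0r !scale0r.
rewrite !exprS -!scalerA; set w := b ^+ l *: v.
move: (rec l) IH; rewrite -/w => rl IH.
apply: (@scalar_inj (p + p^-1 - qint p l / qint p l.+1)).
  have -> : p + p^-1 - qint p l / qint p l.+1 = qint p l.+2 / qint p l.+1.
    apply: (mulIf (pn l)); rewrite mulrBl !mulfVK // /qint !exprS.
    have : p ^+ l != 0 by rewrite expf_neq0.
    by move: (p ^+ l) => x x0; nfield.
  by rewrite mulf_neq0 ?invr_eq0 ?pn.
apply: (eq_of_relation (c := -1) rl).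
ncv K A [:: a; b] w IH; last ring.
have := qint_den p0 (pn l); have := qint_den p0 (pn l.+1).
rewrite /qint !exprS; have : p ^+ l != 0 by rewrite expf_neq0.
move: (p ^+ l) => x x0 d2 d1; nfield.
Qed.

Lemma q2P n : (0 < n)%N -> (q ^+ 2) ^+ n != 1.
Proof. by move=> n0; rewrite -exprM qP // muln_gt0. Qed.

Let q20' : q ^+ 2 != 0. Proof. by rewrite expf_neq0. Qed.
Let qs20 : (q ^+ 2) ^+ 2 - 1 != 0. Proof. by rewrite subr_eq0 q2P. Qed.

Lemma qint_neq0 (p : K) n : p != 0 -> (forall m, (0 < m)%N -> p ^+ m != 1) ->
  qint p n.+1 != 0.
Proof.
move=> p0 pP; rewrite /qint.
have x0 : p ^+ n.+1 != 0 by rewrite expf_neq0.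
have -> : p ^+ n.+1 - p ^- n.+1 = ((p ^+ n.+1) ^+ 2 - 1) / p ^+ n.+1.
  by move: (p ^+ n.+1) x0 => x x0; nfield.
have -> : p - p^-1 = (p ^+ 2 - 1) / p by nfield.
by rewrite !mulf_neq0 ?invr_eq0 ?mulf_neq0 ?invr_eq0 ?subr_eq0 -?exprM ?pP.
Qed.

Lemma qint_q_neq0 n : qint q n.+1 != 0. Proof. exact: qint_neq0. Qed.

Lemma qint_qq_neq0 n : qint (q ^+ 2) n.+1 != 0.
Proof. by apply: qint_neq0 => //; exact: q2P. Qed.

(** * The vectors f_2^l f_theta^m 1_lambda, with m for the k of the statement *)

Definition wv m : M := fth ^+ m *: v0.
Definition uv l m : M := f2 ^+ l *: wv m.

Lemma wvS m : wv m.+1 = fth *: wv m. Proof. by rewrite /wv exprS scalerA. Qed.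

Lemma uv0 m : uv 0 m = wv m. Proof. by rewrite /uv scale1r. Qed.

Lemma uvS l m : uv l.+1 m = f2 *: uv l m.
Proof. by rewrite /uv exprS scalerA. Qed.

Lemma f_wv m : [/\ f1 *: wv m = 0, f3 *: wv m = 0 & fde *: wv m = 0].
Proof.
elim: m => [|m [h1 h3 hd]]; first by rewrite /wv scale1r.
rewrite wvS; split.
- by ncv K A [:: f1; fde; fth] (wv m) (f1_fth, (h1, hd)).
- by ncv K A [:: f3; fth] (wv m) (f3_fth, h3).
- by ncv K A [:: fde; fth] (wv m) (fde_fth, hd).
Qed.

Lemma k_wv m : [/\ k1 *: wv m = 1 *:: wv m, k2 *: wv m = (z / q ^+ m) *:: wv m
  & k3 *: wv m = 1 *:: wv m].
Proof.
elim: m => [|m [h1 h2 h3]]; first by rewrite /wv expr0 scale1r divr1.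
rewrite wvS; split.
- by ncv K A [:: k1; fth] (wv m) (k1_fth, h1); ring.
- ncv K A [:: k2; fth] (wv m) (k2_fth, h2).
  have : q ^+ m != 0 by rewrite expf_neq0.
  by rewrite exprS; move: (q ^+ m) => x x0; nfield.
- by ncv K A [:: k3; fth] (wv m) (k3_fth, h3); ring.
Qed.

Lemma e_wv m : e1 *: wv m = 0 /\ e3 *: wv m = 0.
Proof.
elim: m => [|m [h1 h3]]; first by rewrite /wv scale1r.
have [_ _ hd] := f_wv m; have [hk _ _] := k_wv m.
rewrite wvS; split.
- by ncv K A [:: e1; fde; fth; k1] (wv m) (e1_fth, (h1, (hk, hd))).
- by ncv K A [:: e3; fth] (wv m) (e3_fth, h3).
Qed.

Lemma e_uv l m : e1 *: uv l m = 0 /\ e3 *: uv l m = 0.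
Proof.
elim: l => [|l [h1 h3]]; first by rewrite uv0; exact: e_wv.
rewrite uvS !scalerA !e_f_neq // -!scalerA h1 h3.
by rewrite !scaler0.
Qed.

Lemma k_uv l m : [/\ k1 *: uv l m = (q ^+ l) *:: uv l m,
  k2 *: uv l m = (z / (q ^+ m * (q ^+ l) ^+ 2)) *:: uv l m
  & k3 *: uv l m = ((q ^+ 2) ^+ l) *:: uv l m].
Proof.
elim: l => [|l [h1 h2 h3]].
  by rewrite uv0 !expr0 expr1n mulr1; exact: k_wv.
rewrite uvS; split.
- by rewrite (k_f_act n2 h1) exprS.
- rewrite (k_f_act n2 h2) (exprS q l); congr (_%:A *: _).
  have : q ^+ m != 0 by rewrite expf_neq0.
  have : q ^+ l != 0 by rewrite expf_neq0.
  rewrite /weight_factor /=; move: (q ^+ m) (q ^+ l) => y x x0 y0.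
  by nfield.
- by rewrite (k_f_act n2 h3) (exprS (q ^+ 2) l).
Qed.

Lemma fde_uv l m : fde *: uv l m = 0.
Proof.
elim: l => [|l IH]; first by rewrite uv0; case: (f_wv m).
by rewrite uvS scalerA -f2_fde -scalerA IH scaler0.
Qed.

Lemma f1_pow_uv l m : f1 ^+ l.+1 *: uv l m = 0.
Proof.
elim: l => [|l IH]; first by rewrite uv0 expr1; case: (f_wv m).
by rewrite uvS; apply: serre_pow_kill IH; exact: serre12.
Qed.

Lemma f3_pow_uv l m : f3 ^+ l.+1 *: uv l m = 0.
Proof.
elim: l => [|l IH]; first by rewrite uv0 expr1; case: (f_wv m).
by rewrite uvS; apply: serre_pow_kill IH; exact: serre32.
Qed.

Lemma f2_f1_uv l m : f2 *: (f1 *: uv l m) =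
  (qint q l / qint q l.+1) *:: (f1 *: (f2 *: uv l m)).
Proof.
have [h1 _ _] := f_wv m.
apply: serre_string => //; first exact: qint_q_neq0.
move=> n; ncv K A [:: f1; f2] (f2 ^+ n *: wv m) serre21; ring.
Qed.

Lemma f2_f3_uv l m : f2 *: (f3 *: uv l m) =
  (qint (q ^+ 2) l / qint (q ^+ 2) l.+1) *:: (f3 *: (f2 *: uv l m)).
Proof.
have [_ h3 _] := f_wv m.
apply: serre_string => //; first exact: qint_qq_neq0.
move=> n; rewrite -/(uv n m); have := fde_uv n m; rewrite /fde => hd.
apply: (eq_of_relation (c := 1) hd).
ncv K A [:: f2; f3] (uv n m) tt; ring.
Qed.

Local Notation Q := (q ^+ 2).

Lemma expQ l : Q ^+ l = (q ^+ l) ^+ 2. Proof. exact: exprAC. Qed.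

(** Isolates q^l, which is then generalised to a variable, so that identities of q-integers become
    identities of rational functions. The order [j + l] makes [1 + l] convertible to [l.+1]. *)
Lemma qint_shift j l :
  qint q (j + l) = (q ^+ j * q ^+ l - (q ^+ j * q ^+ l)^-1) / (q - q^-1).
Proof. by rewrite /qint exprD. Qed.

Lemma qint_qq_shift j l : qint Q (j + l) =
  ((q ^+ j * q ^+ l) ^+ 2 - (q ^+ j * q ^+ l) ^- 2) / (Q - Q^-1).
Proof. by rewrite /qint expQ exprD. Qed.

Lemma qpow_neq0 l : q ^+ l != 0. Proof. by rewrite expf_neq0. Qed.

Lemma qpow_sub1_neq0 j l n : (q ^+ j.+1 * q ^+ l) ^+ n.+1 - 1 != 0.
Proof. by rewrite -exprD -exprM subr_eq0 qP. Qed.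

(** The product of the ratios in [f2_f1_uv] and [f2_f3_uv] at [l.+1]. The term with [theta_coef]
    measures how far f_2 is from passing f_1 and f_3 independently. *)
Definition raise_coef l : K :=
  qint q l.+1 * qint Q l.+1 / (qint q l.+2 * qint Q l.+2).

Definition theta_coef l : K :=
  q * qint Q l.+1 * (q + q^-1) / ((q - q^-1) * qint q l.+2).

Lemma fth_uv l m : fth *: uv l m = (q ^+ l) *:: uv l m.+1.
Proof.
elim: l => [|l IH]; first by rewrite !uv0 wvS !scale1r.
rewrite !uvS exprS.
have : f2 *: (fth *: uv l m) = q^-1 *:: (fth *: (f2 *: uv l m)).
  by ncv K A [:: f2; fth] (uv l m) f2_fth; ring.
rewrite IH scalar_act_comm => /(congr1 (fun v => q *:: v)).
by rewrite !scalarA mulfV // !scale1r.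
Qed.

(* For l = 0 this is the definition of f_theta; the induction step is the Serre
   relation of f_1 and f_2, applied to f_3 f_2 u. *)
Let f2_f31_fth l m :
  f2 *: (f3 *: (f1 *: (f2 *: uv l m))) =
  raise_coef l *:: (f3 *: (f1 *: (f2 *: (f2 *: uv l m)))) +
  (theta_coef l / q ^+ l) *:: (fth *: uv l m).
Proof.
elim: l => [|l IH].
  have [h1 h3 _] := f_wv m; have g1 := f2_f1_uv 1 m; have g3 := f2_f3_uv 1 m.
  rewrite !uvS !uv0 in g1 g3; rewrite uv0.
  rewrite /fth /fxi /fx /qcomm /raise_coef /theta_coef /qint.
  rewrite /qint in g1 g3.
  have q8 : q ^+ 8 - 1 != 0 by rewrite subr_eq0 qP.
  by ncv K A [:: f1; f2; f3] (wv m) (f13, ((h1, h3), (g1, g3))); nfield.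
have g1 := f2_f3_uv l.+1 m; have g2 := f2_f3_uv l.+2 m.
rewrite !uvS in g1 g2; rewrite !uvS.
have rel := congr1 (fun a => a *: (f3 *: (f2 *: uv l m))) serre21.
(* This is the total coefficient of the unknown vector f_2 f_3 f_1 f_2^2 u in the Serre relation,
   once the induction hypothesis and [f2_f3_uv] are inserted. *)
apply: (@scalar_inj ((q + q^-1) * (qint Q l.+1 / qint Q l.+2) - raise_coef l)).
  have -> : (q + q^-1) * (qint Q l.+1 / qint Q l.+2) - raise_coef l =
      qint Q l.+1 * qint q l.+3 / (qint Q l.+2 * qint q l.+2).
    rewrite /raise_coef.
    rewrite !(qint_shift 1 l : qint q l.+1 = _).
    rewrite !(qint_shift 2 l : qint q l.+2 = _).
    rewrite !(qint_shift 3 l : qint q l.+3 = _).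
    rewrite !(qint_qq_shift 1 l : qint Q l.+1 = _).
    rewrite !(qint_qq_shift 2 l : qint Q l.+2 = _).
    move: (qpow_neq0 l) (qpow_sub1_neq0 1 l 1) (qpow_sub1_neq0 1 l 3).
    by move: (q ^+ l) => x x0 x1 x2; nfield.
  apply: mulf_neq0; rewrite ?invr_eq0; apply: mulf_neq0;
    by rewrite ?qint_q_neq0 ?qint_qq_neq0.
apply: (eq_of_relation (c := -1) rel).
rewrite /raise_coef /theta_coef in IH *.
rewrite (qint_shift 1 l : qint q l.+1 = _) (qint_shift 2 l : qint q l.+2 = _)
  (qint_qq_shift 1 l : qint Q l.+1 = _) (qint_qq_shift 2 l : qint Q l.+2 = _)
  in IH g1 g2 *.
rewrite (qint_qq_shift 3 l : qint Q l.+3 = _) in g2 *.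
rewrite (qint_shift 3 l : qint q l.+3 = _) (exprS q l).
move: (qpow_neq0 l) (qpow_sub1_neq0 1 l 1) (qpow_sub1_neq0 1 l 3)
  (qpow_sub1_neq0 2 l 1) (qpow_sub1_neq0 2 l 3) IH g1 g2 {rel}.
move: (uv l m) (q ^+ l) => u x x0 d1 d2 d3 d4 IH g1 g2.
by ncv K A [:: f1; f2; f3; fth] u (f13, (f2_fth, (IH, (g1, g2)))); nfield.
Qed.

Lemma f2_f31_uv l m : f2 *: (f3 *: (f1 *: uv l.+1 m)) =
  raise_coef l *:: (f3 *: (f1 *: uv l.+2 m)) + theta_coef l *:: uv l m.+1.
Proof.
rewrite !uvS f2_f31_fth fth_uv scalarA mulfVK //.
exact: qpow_neq0.
Qed.

(** * The action of e_2 *)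

Lemma fxi_wv m : fxi *: wv m = (- q ^- 2) *:: (f3 *: (f1 *: (f2 *: wv m))).
Proof.
have [h1 h3 _] := f_wv m; rewrite /fxi /fx /qcomm.
by ncv K A [:: f1; f2; f3] (wv m) (f13, (h1, h3)); ring.
Qed.

Let z0 : z != 0.
Proof.
apply/eqP => zz; move/eqP: z2; rewrite zz expr0n /= eq_sym oppr_eq0 invr_eq0.
by rewrite expf_eq0 /= (negPf q0).
Qed.

Let zV : z = - q ^- 2 * z^-1.
Proof. by rewrite -z2 expr2 mulfK. Qed.

Lemma kV2_wv m : kV2 *: wv m = (q ^+ m / z) *:: wv m.
Proof.
have [_ h _] := k_wv m; rewrite (kV_act _ h) ?invf_div //.
by rewrite mulf_neq0 ?invr_eq0 ?qpow_neq0.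
Qed.

(** The m + 1 places where e_2 can turn an f_theta into f_xi contribute q^m, q^(m-2), ..., q^(-m),
    which add up to the q-integer. *)
Lemma e2_wv m : e2 *: wv m.+1 = (z^-1 * qint q m.+1) *:: (fxi *: wv m).
Proof.
elim: m => [|m IH].
  have h := kV2_wv 0; have e0 : e2 *: wv 0 = 0 by rewrite /wv scale1r.
  rewrite expr0 in h; rewrite wvS.
  by ncv K A [:: e2; fth; fxi; kV2] (wv 0) (e2_fth, (e0, h));
    rewrite /qint; nfield.
have h := kV2_wv m.+1; rewrite wvS in h IH; rewrite !wvS.
apply: (@scalar_inj q) => //.
ncv K A [:: e2; fth; fxi; kV2] (wv m) (IH, (e2_fth, (fxi_fth, h))).
rewrite (qint_shift 2 m : qint q m.+2 = _) (qint_shift 1 m : qint q m.+1 = _).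
rewrite (exprS q m); move: (q ^+ m) (qpow_neq0 m) => x x0; nfield.
Qed.

(** The factor (q + q^-1) [l]_(q^2) is [2l]_q. The product form is due to z^2 = - q^-2, which turns
    z x - (z x)^-1 into - z^-1 (q^-2 x + x^-1). *)
Definition lower_coef l m : K :=
  - z^-1 * q^-1 * (q + q^-1) * qint Q l * qint q (m + l).+1 /
    (qint q l.+1 * (q - q^-1)).

Definition mixed_coef l m : K :=
  - z^-1 * q ^- 2 * qint q m / (qint q l.+1 * qint Q l.+1).

Lemma qint0 (p : K) : qint p 0 = 0.
Proof. by rewrite /qint expr0 invr1 subrr mul0r. Qed.

Lemma sub_inv_neq0 (p : K) : p != 0 -> p ^+ 2 - 1 != 0 -> p - p^-1 != 0.
Proof.
move=> p0 p1; have -> : p - p^-1 = (p ^+ 2 - 1) / p by nfield.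
by rewrite mulf_neq0 ?invr_eq0.
Qed.

Lemma qint1 (p : K) : p - p^-1 != 0 -> qint p 1 = 1.
Proof. by move=> p1; rewrite /qint expr1 mulfV. Qed.

(** Moving e_2 past one more f_2 yields three contributions: the old coefficient, the f_theta term
    of [f2_f31_uv], and the commutator of e_2 and f_2. *)
Lemma lower_coef_step l m :
  lower_coef l m.+1 + mixed_coef l m.+1 * theta_coef l +
    (z / (q ^+ m.+1 * (q ^+ l) ^+ 2) - (z / (q ^+ m.+1 * (q ^+ l) ^+ 2))^-1)
      / (q - q^-1) = lower_coef l.+1 m.+1.
Proof.
(* Only the z in the numerator of the eigenvalue is replaced, after which both sides are multiples
   of z^-1. *)
rewrite /lower_coef /mixed_coef /theta_coef invf_div [in z / _]zV.
rewrite addnS addSn.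
rewrite (qint_shift 1 l : qint q l.+1 = _) (qint_shift 2 l : qint q l.+2 = _)
  (qint_qq_shift 1 l : qint Q l.+1 = _) (qint_qq_shift 0 l : qint Q l = _)
  (qint_shift 1 m : qint q m.+1 = _)
  (qint_shift 2 (m + l) : qint q (m + l).+2 = _)
  (qint_shift 3 (m + l) : qint q (m + l).+3 = _) exprD (exprS q m).
move: (qpow_neq0 l) (qpow_sub1_neq0 0 l 1) (qpow_sub1_neq0 0 l 3)
  (qpow_sub1_neq0 1 l 1) (qpow_neq0 m).
move: (q ^+ l) (q ^+ m) => x y x0 d1 d2 d3 y0.
nfield.
Qed.

Lemma lower_coef_step0 l :
  lower_coef l 0 + (z / (q ^+ 0 * (q ^+ l) ^+ 2) -
    (z / (q ^+ 0 * (q ^+ l) ^+ 2))^-1) / (q - q^-1) = lower_coef l.+1 0.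
Proof.
rewrite /lower_coef invf_div [in z / _]zV !add0n mul1r.
rewrite (qint_shift 1 l : qint q l.+1 = _) (qint_shift 2 l : qint q l.+2 = _)
  (qint_qq_shift 1 l : qint Q l.+1 = _) (qint_qq_shift 0 l : qint Q l = _).
move: (qpow_neq0 l) (qpow_sub1_neq0 0 l 1) (qpow_sub1_neq0 1 l 1).
move: (q ^+ l) => x x0 d1 d2.
nfield.
Qed.

Lemma mixed_coef_step l m :
  mixed_coef l m * raise_coef l = mixed_coef l.+1 m.
Proof.
rewrite /mixed_coef /raise_coef.
have := (qint_q_neq0 l, qint_qq_neq0 l, qint_q_neq0 l.+1, qint_qq_neq0 l.+1).
move: (qint q l.+1) (qint Q l.+1) (qint q l.+2) (qint Q l.+2) (qint q m).
by move=> a b c d g [[[a0 b0] c0] d0]; nfield.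
Qed.

(* For m = 0 or l = 0 the coefficient of the vector with a truncated index
   vanishes. *)
Lemma e2_uv l m : e2 *: uv l m = lower_coef l m *:: uv l.-1 m +
  mixed_coef l m *:: (f3 *: (f1 *: uv l.+1 m.-1)).
Proof.
elim: l => [|l IH].
  rewrite /lower_coef qint0 mulr0 !mul0r !scale0r add0r uv0 uvS uv0.
  case: m => [|m].
    by rewrite /mixed_coef qint0 mulr0 mul0r !scale0r /wv scale1r.
  rewrite e2_wv fxi_wv scalarA /mixed_coef; congr (_%:A *: _).
  rewrite !qint1 ?sub_inv_neq0 //.
  by move: (qint q _) => c; nfield.
have low : lower_coef l m *:: (f2 *: uv l.-1 m) = lower_coef l m *:: uv l m.
  case: (l) => [|l']; last by rewrite uvS.
  by rewrite /lower_coef qint0 mulr0 !mul0r !scale0r.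
have [_ hk _] := k_uv l m.
rewrite uvS (e_f_act _ hk); last first.
  by rewrite mulf_neq0 ?invr_eq0 ?mulf_neq0 ?expf_neq0.
rewrite IH scalerDr !scalar_act_comm low.
case: m {IH low hk} => [|m].
  rewrite /mixed_coef qint0 mulr0 !mul0r !scale0r !addr0 scalarDl.
  by rewrite lower_coef_step0.
rewrite f2_f31_uv scalerDr !scalarA mixed_coef_step addrAC addrA addrAC.
by rewrite !scalarDl -lower_coef_step addrAC.
Qed.

(** * Span of the system *)

Definition bv l m i j : M := f1 ^+ i *: (f3 ^+ j *: uv l m).

Lemma comm_pow_act (a b : A) n (v : M) : a * b = b * a ->
  a *: (b ^+ n *: v) = b ^+ n *: (a *: v).
Proof. by move/(commrX n) => ab; rewrite !scalerA ab. Qed.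

Definition bv_weight i l m a b : K :=
  weight_factor i n1 ^+ a * (weight_factor i n3 ^+ b *
    nth 0 [:: q ^+ l; z / (q ^+ m * (q ^+ l) ^+ 2); Q ^+ l] i).

Lemma k_bv i l m a b :
  k i *: bv l m a b = bv_weight i l m a b *:: bv l m a b.
Proof.
apply: k_f_pow_act; apply: k_f_pow_act; have [h1 h2 h3] := k_uv l m.
have [->|[->|->]] : i = n1 \/ i = n2 \/ i = n3 => //.
case: i => [[|[|[|//]]] ?]; [left|right; left|right; right]; exact: val_inj.
Qed.

Lemma bv_weight_neq0 i l m a b : bv_weight i l m a b != 0.
Proof.
rewrite /bv_weight !mulf_neq0 ?expf_neq0 ?weight_factor_neq0 //.
by case: i => [[|[|[|//]]] ?] /=; rewrite ?mulf_neq0 ?invr_eq0 ?mulf_neq0 ?expf_neq0.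
Qed.

(** The span as an intersection of subspaces, so that membership is used by induction; coefficients
    are extracted only in [yv_span]. *)
Definition in_span (v : M) : Prop :=
  forall S : M -> Prop, S 0 -> (forall c u w, S u -> S w -> S (c *:: u + w)) ->
    (forall l m i j, (i <= l)%N -> (j <= l)%N -> S (bv l m i j)) -> S v.

Lemma in_span0 : in_span 0. Proof. by move=> S S0. Qed.

Lemma in_span_comb c u w : in_span u -> in_span w -> in_span (c *:: u + w).
Proof.
by move=> hu hw S S0 SD Sb; apply: (SD); [exact: hu S S0 SD Sb|exact: hw S S0 SD Sb].
Qed.

Lemma in_spanZ c u : in_span u -> in_span (c *:: u).
Proof.
by move=> hu; rewrite -[_ *: u]addr0; apply: in_span_comb => //; exact: in_span0.
Qed.

(** Vectors with i or j beyond l vanish, which spares boundary cases for f_1 and f_3. *)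
Lemma in_span_bv l m i j : in_span (bv l m i j).
Proof.
have [il|li] := leqP i l; last first.
  rewrite /bv -comm_pow_act; last by rewrite -commrX //; exact: f13.
  by rewrite -(subnK li) exprD -scalerA f1_pow_uv !scaler0; exact: in_span0.
have [jl|lj] := leqP j l; last first.
  by rewrite /bv -(subnK lj) exprD -scalerA f3_pow_uv !scaler0; exact: in_span0.
by move=> S _ _; apply.
Qed.

Lemma in_span_act (x : A) :
    (forall l m i j, in_span (x *: bv l m i j)) ->
  forall v, in_span v -> in_span (x *: v).
Proof.
move=> xb v vS; apply: (vS (fun v => in_span (x *: v))) => //.
- by rewrite scaler0; exact: in_span0.
- by move=> c u w hu hw; rewrite scalerDr scalar_act_comm; exact: in_span_comb.
Qed.

Lemma in_span_f1 v : in_span v -> in_span (f1 *: v).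
Proof.
apply: in_span_act => l m i j; rewrite /bv scalerA -exprS.
exact: (in_span_bv l m i.+1 j).
Qed.

Lemma in_span_f3 v : in_span v -> in_span (f3 *: v).
Proof.
apply: in_span_act => l m i j.
rewrite /bv comm_pow_act ?f13 // (scalerA f3) -exprS.
exact: (in_span_bv l m i j.+1).
Qed.

Lemma in_span_pow (x : A) n v : (forall v, in_span v -> in_span (x *: v)) ->
  in_span v -> in_span (x ^+ n *: v).
Proof.
move=> xS vS; elim: n => [|n IH]; first by rewrite scale1r.
by rewrite exprS -scalerA; apply: xS.
Qed.

(** The Serre relation expresses f_2 a^(i+2) v through a f_2 a^(i+1) v and a^2 f_2 a^i v, so
    exponents 0 and 1 suffice. *)
Lemma in_span_serre (a : A) (c : K) v i :
    (forall v, in_span v -> in_span (a *: v)) ->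
    a * a * f2 = c *: (a * f2 * a) - f2 * a * a ->
    in_span (f2 *: v) -> in_span (f2 *: (a *: v)) ->
  in_span (f2 *: (a ^+ i *: v)).
Proof.
move=> aS ab h0 h1.
suff [] : in_span (f2 *: (a ^+ i *: v)) /\ in_span (f2 *: (a ^+ i.+1 *: v)) by [].
elim: i => [|i [IH1 IH2]]; first by rewrite expr1 scale1r.
split=> //.
have -> : f2 *: (a ^+ i.+2 *: v) = c *:: (a *: (f2 *: (a ^+ i.+1 *: v))) +
    (-1) *:: (a *: (a *: (f2 *: (a ^+ i *: v)))).
  rewrite (exprS a i.+1) (exprS a i) -!scalerA.
  have rel := congr1 (fun x => x *: (a ^+ i *: v)) ab.
  apply: (eq_of_relation (c := 1) rel).
  by ncv K A [:: a; f2] (a ^+ i *: v) tt; ring.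
by apply: in_span_comb; [|apply: in_spanZ]; do ?apply: (aS).
Qed.

Lemma in_span_f2 v : in_span v -> in_span (f2 *: v).
Proof.
apply: in_span_act => l m i j.
have uS n : in_span (uv n m).
  by have := in_span_bv n m 0 0; rewrite /bv !scale1r.
have h : in_span (f2 *: uv l m) by rewrite -uvS.
have h1 : in_span (f2 *: (f1 *: uv l m)).
  by rewrite f2_f1_uv; apply: in_spanZ; apply: in_span_f1.
have h3 : in_span (f2 *: (f3 *: uv l m)).
  by rewrite f2_f3_uv; apply: in_spanZ; apply: in_span_f3.
have h31 : in_span (f2 *: (f3 *: (f1 *: uv l m))).
  case: (l) => [|n].
    by rewrite uv0; have [-> _ _] := f_wv m; rewrite !scaler0; exact: in_span0.
  rewrite f2_f31_uv; apply: in_span_comb.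
    by apply: in_span_f3; apply: in_span_f1.
  apply: in_spanZ.
  by have := in_span_bv n m.+1 0 0; rewrite /bv !scale1r.
(* Induction on the exponent of f_1; each of its two initial cases is an induction on the exponent
   of f_3, started from [h], [h3] and from [h1], [h31]. *)
apply: (in_span_serre _ in_span_f1 serre12).
  exact: (in_span_serre _ in_span_f3 serre32).
rewrite comm_pow_act ?f13 //.
exact: (in_span_serre _ in_span_f3 serre32).
Qed.

Lemma e1_bv l m i j : e1 *: bv l m i.+1 j =
  (qint q i.+1 * ((q ^+ l / q ^+ i - q ^+ i / q ^+ l) / (q - q^-1))) *::
    bv l m i j.
Proof.
apply: e_f_pow_act => //; rewrite ?expf_neq0 //.
- have [h _ _] := k_uv l m; rewrite (k_f_pow_act n3 j h).
  by rewrite /weight_factor /= expr1n mul1r.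
- by rewrite comm_pow_act ?e_f_neq //; have [-> _] := e_uv l m; rewrite scaler0.
Qed.

Lemma e1_bv0 l m j : e1 *: bv l m 0 j = 0.
Proof.
rewrite /bv scale1r comm_pow_act ?e_f_neq //.
by have [-> _] := e_uv l m; rewrite scaler0.
Qed.

Lemma e3_bv l m i j : e3 *: bv l m i j.+1 =
  (qint Q j.+1 * ((Q ^+ l / Q ^+ j - Q ^+ j / Q ^+ l) / (q - q^-1))) *::
    bv l m i j.
Proof.
rewrite /bv comm_pow_act ?e_f_neq // -scalar_act_comm; congr (_ *: _).
have [_ _ h] := k_uv l m; have [_ h3] := e_uv l m.
apply: e_f_pow_act => //; rewrite ?expf_neq0 //.
by rewrite /weight_factor /= -exprM.
Qed.

Lemma e3_bv0 l m i : e3 *: bv l m i 0 = 0.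
Proof.
rewrite /bv scale1r comm_pow_act ?e_f_neq //.
by have [_ ->] := e_uv l m; rewrite scaler0.
Qed.

Lemma in_span_e i v : in_span v -> in_span (e i *: v).
Proof.
apply: in_span_act => l m a b.
have [->|[->|->]] : i = n1 \/ i = n2 \/ i = n3.
- by case: i => [[|[|[|//]]] ?]; [left|right; left|right; right]; exact: val_inj.
- case: a => [|a]; first by rewrite e1_bv0; exact: in_span0.
  by rewrite e1_bv; apply: in_spanZ; apply: in_span_bv.
- rewrite /bv (@comm_pow_act e2 f1) ?(@comm_pow_act e2 f3) ?e_f_neq // e2_uv.
  apply: in_span_pow => [|]; first exact: in_span_f1.
  apply: in_span_pow => [|]; first exact: in_span_f3.
  apply: in_span_comb; last apply: in_spanZ.
    by have := in_span_bv l.-1 m 0 0; rewrite /bv !scale1r.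
  apply: in_span_f3; apply: in_span_f1.
  by have := in_span_bv l.+1 m.-1 0 0; rewrite /bv !scale1r.
- case: b => [|b]; first by rewrite e3_bv0; exact: in_span0.
  by rewrite e3_bv; apply: in_spanZ; apply: in_span_bv.
Qed.

Lemma in_span_k i v : in_span v -> in_span (k i *: v).
Proof.
by apply: in_span_act => l m a b; rewrite k_bv; apply: in_spanZ; apply: in_span_bv.
Qed.

Lemma in_span_kV i v : in_span v -> in_span (kV i *: v).
Proof.
apply: in_span_act => l m a b.
rewrite (kV_act _ (k_bv _ _ _ _ _)) ?bv_weight_neq0 //.
by apply: in_spanZ; apply: in_span_bv.
Qed.

Lemma in_span_f i v : in_span v -> in_span (f i *: v).
Proof.
have [->|[->|->]] : i = n1 \/ i = n2 \/ i = n3.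
- by case: i => [[|[|[|//]]] ?]; [left|right; left|right; right]; exact: val_inj.
- exact: in_span_f1.
- exact: in_span_f2.
- exact: in_span_f3.
Qed.

(** The premise says that [A] is generated by the letters; the span contains [v0] and is stable
    under each letter. *)
Lemma in_span_total :
    (forall P : A -> Prop, P 1 ->
      (forall a x y, P x -> P y -> P (a *: x + y)) ->
      (forall i x, P x -> [/\ P (e i * x), P (f i * x), P (k i * x)
                            & P (kV i * x)]) -> forall x, P x) ->
  forall x : A, in_span (x *: v0).
Proof.
move=> ind; apply: ind => [|a x y hx hy|i x hx].
- have -> : 1 *: v0 = bv 0 0 0 0 by rewrite /bv /uv /wv !scale1r.
  exact: in_span_bv.
- have -> : (a *: x + y) *: v0 = a *:: (x *: v0) + y *: v0.
    by rewrite scalerDl scalerA -scalerAl mul1r.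
  exact: in_span_comb.
- rewrite -!scalerA; split.
  + exact: in_span_e.
  + exact: in_span_f.
  + exact: in_span_k.
  + exact: in_span_kV.
Qed.

(** * Contravariant form *)

Section Form.
Variable B : M -> M -> K.
Hypothesis B_lin : forall c u v w, B (c *:: u + v) w = c * B u w + B v w.
Hypothesis B_sym : forall u v, B u v = B v u.
Hypothesis B_k : forall i u v, B (k i *: u) v = B u (k i *: v).
Hypothesis B_f_contra : forall i u v, B (f i *: u) v = B u (- (kV i * e i) *: v).
Hypothesis B_v0 : B v0 v0 = 1.

Lemma B0l v : B 0 v = 0.
Proof.
have := B_lin 1 0 0 v; rewrite scaler0 addr0 mul1r => /eqP.
by rewrite -subr_eq0 opprD addNKr oppr_eq0 => /eqP.
Qed.

Lemma B0r v : B v 0 = 0. Proof. by rewrite B_sym B0l. Qed.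

Lemma BZl c u v : B (c *:: u) v = c * B u v.
Proof. by rewrite -[c *:: u]addr0 B_lin B0l addr0. Qed.

Lemma BZr c u v : B u (c *:: v) = c * B u v.
Proof. by rewrite B_sym BZl B_sym. Qed.

Lemma BDl u v w : B (u + v) w = B u w + B v w.
Proof.
have -> : u + v = 1 *:: u + v by rewrite !scale1r.
by rewrite B_lin mul1r.
Qed.

Lemma BDr u v w : B w (u + v) = B w u + B w v.
Proof. by rewrite B_sym BDl !(B_sym w). Qed.

Lemma B_weight i a b u v :
  k i *: u = a *:: u -> k i *: v = b *:: v -> a != b -> B u v = 0.
Proof.
move=> ku kv ab; have := B_k i u v; rewrite ku kv BZl BZr => /eqP.
by rewrite -subr_eq0 -mulrBl mulf_eq0 subr_eq0 (negPf ab) => /eqP.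
Qed.

Lemma B_kV i u v : B (kV i *: u) v = B u (kV i *: v).
Proof.
have kK (w : M) : k i *: (kV i *: w) = w by rewrite scalerA k_kV scale1r.
by rewrite -{1}(kK v) -B_k kK.
Qed.

(** The factor q^(-h_i) is moved back to the first argument, so that it can act on a vector of known
    weight. *)
Lemma B_f i u v : B (f i *: u) v = - B (kV i *: u) (e i *: v).
Proof.
have E : (- (kV i * e i)) *: v = (-1) *:: (kV i *: (e i *: v)).
  by rewrite (scaleN1r (1 : A)) scaleN1r scaleNr scalerA.
by rewrite B_f_contra E BZr mulN1r B_kV.
Qed.

(** * Orthogonality and norms along the strings of one f_i *)

Section Chain.
Variables (i : 'I_3) (p c : K) (u : M).
Hypotheses (p0 : p != 0) (p1 : p ^+ 2 - 1 != 0).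
Hypothesis pP : weight_factor i i = p ^- 2.
Hypotheses (c0 : c != 0) (ku : k i *: u = c *:: u) (eu : e i *: u = 0).

Lemma kV_f_pow_act s :
  kV i *: (f i ^+ s *: u) = ((p ^+ s) ^+ 2 / c) *:: (f i ^+ s *: u).
Proof.
rewrite (kV_act _ (k_f_pow_self s pP ku)) ?invf_div //.
by rewrite mulf_neq0 ?invr_eq0 ?expf_neq0.
Qed.

(** Each f_i moved across the form lowers both exponents until e_i meets u and kills it; hence [v]
    may be any vector. *)
Lemma B_f_pow_lt v s t : (s < t)%N -> B (f i ^+ s *: u) (f i ^+ t *: v) = 0.
Proof.
elim: s t => [|s IH] [|t] // st.
  by rewrite B_sym exprS -scalerA B_f scale1r eu B0r oppr0.
rewrite B_sym (exprS _ t) -scalerA B_f (e_f_pow_act s p0 p1 pP c0 ku eu) BZr.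
rewrite B_kV kV_f_pow_act BZr B_sym IH //.
by rewrite !mulr0 oppr0.
Qed.

Lemma B_f_powS s : B (f i ^+ s.+1 *: u) (f i ^+ s.+1 *: u) =
  - ((p ^+ s) ^+ 2 / c * (qint p s.+1 * ((c / p ^+ s - p ^+ s / c) / (q - q^-1))))
  * B (f i ^+ s *: u) (f i ^+ s *: u).
Proof.
rewrite {1}exprS -scalerA B_f (e_f_pow_act s p0 p1 pP c0 ku eu) BZr.
by rewrite kV_f_pow_act BZl; ring.
Qed.

End Chain.

Lemma dnorm0 (p : K) l : dnorm p l 0 = 1.
Proof. by rewrite /dnorm mul0n !expr0 invr1 !mul1r big_geq. Qed.

Lemma dnormS (p : K) l s : p != 0 -> (s < l)%N ->
  dnorm p l s.+1 = dnorm p l s *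
    (- ((p ^+ s) ^+ 2 / p ^+ l) * (qint p s.+1 * qint p (l - s))).
Proof.
move=> p0 sl; rewrite /dnorm big_nat_recr //= subnSK //.
have -> : p ^- (s.+1 * (l - s)) =
    p ^- (s * (l - s).+1) * ((p ^+ s) ^+ 2 / p ^+ l).
  rewrite -{3}(subnK (ltnW sl)) exprD mulSn mulnS !exprD.
  have := (expf_neq0 s p0, expf_neq0 (l - s) p0, expf_neq0 (s * (l - s)) p0).
  move: (p ^+ s) (p ^+ (l - s)) (p ^+ (s * (l - s))).
  by move=> x y t [[x0 y0] t0]; nfield.
by rewrite exprS; ring.
Qed.

Lemma qint_sub (p : K) l s : p != 0 -> (s <= l)%N ->
  qint p (l - s) = (p ^+ l / p ^+ s - p ^+ s / p ^+ l) / (p - p^-1).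
Proof.
move=> p0 sl; have E : p ^+ l = p ^+ (l - s) * p ^+ s by rewrite -exprD subnK.
rewrite /qint E; congr (_ / _).
have := (expf_neq0 s p0, expf_neq0 (l - s) p0).
by move: (p ^+ s) (p ^+ (l - s)) => x y [x0 y0]; nfield.
Qed.

Lemma dnorm_neq0 (p : K) l s : p != 0 -> (forall m, (0 < m)%N -> p ^+ m != 1) ->
  (s <= l)%N -> dnorm p l s != 0.
Proof.
move=> p0 pP; elim: s => [|s IH] sl; first by rewrite dnorm0 oner_neq0.
rewrite dnormS // mulf_neq0 ?IH 1?ltnW // mulf_neq0 //.
  by rewrite oppr_eq0 mulf_neq0 ?invr_eq0 ?expf_neq0.
by rewrite -subnSK // mulf_neq0 ?qint_neq0.
Qed.

(** Puts f_3 outermost, which lets the string lemmas apply to node [n3]. *)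
Lemma bv_comm l m i j : bv l m i j = f3 ^+ j *: (f1 ^+ i *: uv l m).
Proof.
rewrite /bv comm_pow_act //; apply/esym/commrX/esym; exact: f13.
Qed.

Section Chains.
Variables (l m i j : nat).

Lemma k1_f3_uv : k1 *: (f3 ^+ j *: uv l m) = q ^+ l *:: (f3 ^+ j *: uv l m).
Proof.
have [h _ _] := k_uv l m; rewrite (k_f_pow_act n3 j h).
by rewrite /weight_factor /= expr1n mul1r.
Qed.

Lemma e1_f3_uv : e1 *: (f3 ^+ j *: uv l m) = 0.
Proof.
by rewrite comm_pow_act ?e_f_neq //; have [-> _] := e_uv l m; rewrite scaler0.
Qed.

Lemma k3_f1_uv : k3 *: (f1 ^+ i *: uv l m) = Q ^+ l *:: (f1 ^+ i *: uv l m).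
Proof.
have [_ _ h] := k_uv l m; rewrite (k_f_pow_act n1 i h).
by rewrite /weight_factor /= expr1n mul1r.
Qed.

Lemma e3_f1_uv : e3 *: (f1 ^+ i *: uv l m) = 0.
Proof.
by rewrite comm_pow_act ?e_f_neq //; have [_ ->] := e_uv l m; rewrite scaler0.
Qed.

End Chains.

Let pP1 : weight_factor n1 n1 = q ^- 2. Proof. by []. Qed.
Let pP3 : weight_factor n3 n3 = Q ^- 2.
Proof. by rewrite /weight_factor /= -exprM. Qed.

Lemma qpow_inj a b : q ^+ a = q ^+ b -> a = b.
Proof.
wlog ab : a b / (a <= b)%N.
  by move=> h; case/orP: (leq_total a b) => ab E; [|apply/esym]; apply: h.
rewrite -{1}(subnK ab) exprD => E.
have {E} : q ^+ (b - a) = 1.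
  by apply: (mulIf (qpow_neq0 a)); rewrite mul1r -E.
case: (posnP (b - a)) => [/eqP|/qP /eqP //].
by rewrite subn_eq0 => ba _; apply/eqP; rewrite eqn_leq ab.
Qed.

Lemma B_bv_neq l m i j l' m' i' j' :
  (l, m, i, j) != (l', m', i', j') -> B (bv l m i j) (bv l' m' i' j') = 0.
Proof.
move=> neq.
have lt1 a b a' b' c d c' d' :
    (c < c')%N -> B (bv a b c d) (bv a' b' c' d') = 0.
  by apply: (B_f_pow_lt q0 qs0 pP1 (qpow_neq0 a) (k1_f3_uv a b d) (e1_f3_uv a b d)).
have lt3 a b a' b' c d c' d' :
    (d < d')%N -> B (bv a b c d) (bv a' b' c' d') = 0.
  rewrite !bv_comm.
  by apply: (B_f_pow_lt q20' qs20 pP3 (expf_neq0 a q20') (k3_f1_uv a b c)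
    (e3_f1_uv a b c)).
case: (ltngtP i i') => [|ii|ii]; [exact: lt1|by rewrite B_sym; exact: lt1|].
case: (ltngtP j j') => [|jj|jj]; [exact: lt3|by rewrite B_sym; exact: lt3|].
(* For equal (i, j) the eigenvalue of q^(h_1) separates different l, and that of q^(h_2) separates
   different m once l agrees. *)
subst i' j'; case: (eqVneq l l') => [ll|ll].
  subst l'; apply: (B_weight (k_bv n2 _ _ _ _) (k_bv n2 _ _ _ _)).
  apply: contra neq => /eqP /(mulfI (expf_neq0 _ (weight_factor_neq0 _ _))).
  move=> /(mulfI (expf_neq0 _ (weight_factor_neq0 _ _))) /= /(mulfI z0) /invr_inj.
  by move=> /(mulIf (expf_neq0 _ (qpow_neq0 l))) /qpow_inj ->.
apply: (B_weight (k_bv n1 _ _ _ _) (k_bv n1 _ _ _ _)).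
apply: contra ll => /eqP /(mulfI (expf_neq0 _ (weight_factor_neq0 _ _))).
by move=> /(mulfI (expf_neq0 _ (weight_factor_neq0 _ _))) /= /qpow_inj ->.
Qed.

Lemma B_bv l m i j : (i <= l)%N -> (j <= l)%N ->
  B (bv l m i j) (bv l m i j) =
    qint q 2 ^+ j * dnorm q l i * dnorm Q l j * B (uv l m) (uv l m).
Proof.
elim: i => [|i IH] il jl; last first.
  rewrite /bv (B_f_powS q0 qs0 pP1 (qpow_neq0 l) (k1_f3_uv l m j) (e1_f3_uv l m j)).
  by rewrite (IH (ltnW il) jl) dnormS // (qint_sub q0 (ltnW il)); ring.
elim: j jl => [|j IH] jl.
  by rewrite /bv !dnorm0 !scale1r expr0 !mul1r.
rewrite bv_comm.
rewrite (B_f_powS q20' qs20 pP3 (expf_neq0 l q20') (k3_f1_uv l m 0)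
  (e3_f1_uv l m 0)).
rewrite -bv_comm (IH (ltnW jl)) [dnorm Q l j.+1]dnormS //.
rewrite (qint_sub q20' (ltnW jl)).
(* [dnorm] at q^2 has denominator q^2 - q^-2, the relation of e_3 and f_3 has q - q^-1; their
   quotient is the [2]_q gained with each f_3. *)
have key : (Q - Q^-1)^-1 * qint q 2 = (q - q^-1)^-1.
  by rewrite /qint mulrA mulVf ?mul1r // sub_inv_neq0.
rewrite -[(q - q^-1)^-1]key (exprS (qint q 2) j).
move: (qint q 2) (qint Q j.+1) (Q ^+ j) (Q ^+ l) => a b x y; ring.
Qed.

(** * Recursion and nonvanishing of the norms *)

Lemma two_neq0 : q + q^-1 != 0.
Proof.
have -> : q + q^-1 = (q ^+ 2 + 1) / q by nfield.
by rewrite mulf_neq0 ?invr_eq0.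
Qed.

Ltac neq0 := repeat first [ assumption | exact: qint_q_neq0 | exact: qint_qq_neq0
  | exact: two_neq0 | exact: bv_weight_neq0 | exact: qpow_neq0
  | rewrite oppr_eq0 | rewrite invr_eq0 | apply: mulf_neq0 | apply: expf_neq0
  | apply: sub_inv_neq0 ].

Lemma lower_coef_neq0 l m : lower_coef l.+1 m != 0.
Proof. by rewrite /lower_coef; neq0. Qed.

(** The second vector in [e2_uv] starts with f_3, hence is orthogonal to u, which e_3 kills; only
    [lower_coef] survives. *)
Lemma B_uvS l m : B (uv l.+1 m) (uv l.+1 m) =
  - (z / (q ^+ m * (q ^+ l) ^+ 2))^-1 * lower_coef l.+1 m * B (uv l m) (uv l m).
Proof.
have [_ hk _] := k_uv l m.
rewrite {1}uvS B_f e2_uv (kV_act _ hk); last first.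
  by neq0.
rewrite BZl BDr !BZr [B _ (f3 *: _)]B_sym B_f.
by have [_ ->] := e_uv l m; rewrite B0r oppr0 mulr0 addr0 !mulNr mulrA.
Qed.

(** Obtained by pairing [f2_f31_uv] at l = 0 with w_(m+1) and moving f_2 across the form, where e_2
    returns a multiple of f_3 f_1 f_2 w_m. *)
Lemma B_wvS m : theta_coef 0 * B (wv m.+1) (wv m.+1) =
  - (bv_weight n2 1 m 1 1)^-1 * mixed_coef 0 m.+1 * B (bv 1 m 1 1) (bv 1 m 1 1).
Proof.
have E : f3 *: (f1 *: uv 1 m) = bv 1 m 1 1.
  by rewrite /bv !expr1 !scalerA f13.
have e31 l : B (f3 *: (f1 *: uv l m)) (wv m.+1) = 0.
  by rewrite B_f; have [_ ->] := e_wv m.+1; rewrite B0r oppr0.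
have := f2_f31_uv 0 m; rewrite uv0 E => /(congr1 (B ^~ (wv m.+1))).
rewrite BDl !BZl e31 mulr0 add0r => <-.
rewrite B_f (kV_act _ (k_bv _ _ _ _ _)) ?bv_weight_neq0 // -uv0 e2_uv.
rewrite /lower_coef qint0 mulr0 !mul0r scale0r scale0r add0r E.
by rewrite BZl BZr !mulNr mulrA.
Qed.

Lemma B_uv_neq0 l m : B (uv l m) (uv l m) != 0.
Proof.
have lstep n : B (uv 0 n) (uv 0 n) != 0 -> forall l, B (uv l n) (uv l n) != 0.
  move=> h0; elim=> [|l' IH] //; rewrite B_uvS.
  by apply: mulf_neq0 => //; apply: mulf_neq0; [neq0|exact: lower_coef_neq0].
elim: m l => [|m IH]; apply: lstep; first by rewrite uv0 /wv scale1r B_v0 oner_neq0.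
(* A vanishing norm of w_(m+1) would force the right side of [B_wvS] to vanish, although it is a
   nonzero multiple of the norm of u_(1,m). *)
rewrite uv0; apply/eqP => w0.
have /eqP := B_wvS m; rewrite w0 mulr0 eq_sym; apply/negP.
apply: mulf_neq0; first by rewrite /mixed_coef; neq0.
rewrite B_bv //; apply: mulf_neq0; last exact: IH.
have d1 : dnorm q 1 1 != 0 by exact: dnorm_neq0.
have d2 : dnorm Q 1 1 != 0 by apply: dnorm_neq0 => //; exact: q2P.
by neq0.
Qed.

(** * The normalised system *)

Section OrthonormalBasis.
Variable rt : nat -> nat -> nat -> nat -> K.
Hypothesis rtP : forall l m i j, (i <= l)%N -> (j <= l)%N ->
  rt l m i j ^+ 2 =
    qint q 2 ^+ j * dnorm q l i * dnorm Q l j * B (uv l m) (uv l m).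

Definition yv : yindex -> M :=
  yfamily (fun l m i j => (rt l m i j)^-1 *:: bv l m i j).

Lemma rt_neq0 l m i j : (i <= l)%N -> (j <= l)%N -> rt l m i j != 0.
Proof.
move=> il jl; have : rt l m i j ^+ 2 != 0.
  rewrite rtP //; apply: mulf_neq0; last exact: B_uv_neq0.
  apply: mulf_neq0; last by apply: dnorm_neq0 => //; exact: q2P.
  by apply: mulf_neq0; [neq0|exact: dnorm_neq0].
by rewrite expf_eq0.
Qed.

Lemma B_yv t u : B (yv t) (yv u) = (t == u)%:R.
Proof.
case: (eqVneq t u) => [<-|neq].
  case: t => l [[m i] j]; rewrite /yv /= BZl BZr B_bv -?rtP ?leq_ord //.
  by rewrite expr2 mulKf ?mulVf // rt_neq0 ?leq_ord.
case: t u neq => l [[m i] j] [l' [[m' i'] j']] neq.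
rewrite /yv /= BZl BZr B_bv_neq ?mulr0 //; apply: contra neq => /eqP.
case=> ll mm ii jj; subst l' m'.
by rewrite (val_inj ii) (val_inj jj).
Qed.

Lemma yv_free (s : seq yindex) (a : yindex -> K) : uniq s ->
  \sum_(t <- s) a t *:: yv t = 0 -> forall t, t \in s -> a t = 0.
Proof.
move=> us a0 t ts; have : B (\sum_(u <- s) a u *:: yv u) (yv t) = a t.
  rewrite (big_morph (B ^~ (yv t)) (fun u v => BDl u v (yv t)) (B0l (yv t))).
  rewrite (bigD1_seq t) //= BZl B_yv eqxx mulr1 big1 ?addr0 // => u ut.
  by rewrite BZl B_yv (negPf ut) mulr0.
by rewrite a0 B0l.
Qed.

Lemma yv_span v : in_span v ->
  exists (s : seq yindex) (a : yindex -> K), v = \sum_(t <- s) a t *:: yv t.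
Proof.
move=> vS.
(* Lists of coefficient-index pairs with repetitions are closed under linear combinations by
   concatenation. *)
have [p ->] : exists p : seq (K * yindex), v = \sum_(x <- p) x.1 *:: yv x.2.
  apply: (vS (fun v => exists p : seq (K * yindex),
    v = \sum_(x <- p) x.1 *:: yv x.2)) => [|c u w [p ->] [r ->]|l m i j il jl].
  - by exists [::]; rewrite big_nil.
  - exists ([seq (c * x.1, x.2) | x <- p] ++ r); rewrite big_cat big_map /=.
    by rewrite scaler_sumr; congr (_ + _); apply: eq_bigr => x _; rewrite scalarA.
  - rewrite -ltnS in il; rewrite -ltnS in jl.
    exists [:: (rt l m i j, existT _ l (m, Ordinal il, Ordinal jl))].
    rewrite big_seq1 /yv /= scalarA mulfV ?scale1r ?scale1r //.
    by rewrite rt_neq0.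
(* Repeated indices are merged by adding their coefficients. *)
exists (undup [seq x.2 | x <- p]), (fun t => \sum_(x <- p | x.2 == t) x.1).
transitivity (\sum_(t <- undup [seq x.2 | x <- p])
    \sum_(x <- p | x.2 == t) x.1 *:: yv x.2); last first.
  apply: eq_bigr => t _; rewrite !scaler_suml.
  by apply: eq_bigr => x /eqP ->.
rewrite (exchange_big_dep xpredT) //=; apply: eq_big_seq => x xp.
rewrite big_mkcond (bigD1_seq x.2) ?undup_uniq ?mem_undup ?map_f //= eqxx.
by rewrite big1 ?addr0 // => t tx; rewrite eq_sym (negPf tx).
Qed.

End OrthonormalBasis.

(** The last two premises, generation of [A] by the letters and of [M] by [v0], are later supplied
    by [uq_gen_ind] and [base_cyclic]. *)
Theorem orthonormal_basis_monomials (rt : nat -> nat -> nat -> nat -> K)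
    (c := fun l m : nat =>
       let w := (f2 ^+ l * fth ^+ m) *: v0 in B w w)
    (y := fun l m i j : nat =>
       (rt l m i j)^-1 *:: ((f1 ^+ i * f3 ^+ j * f2 ^+ l * fth ^+ m) *: v0)) :
    (forall l m i j, (i <= l)%N -> (j <= l)%N ->
       rt l m i j ^+ 2 =
         qint q 2 ^+ j * dnorm q l i * dnorm (q ^+ 2) l j * c l m) ->
    (forall P : A -> Prop, P 1 ->
      (forall a x y, P x -> P y -> P (a *: x + y)) ->
      (forall i x, P x -> [/\ P (e i * x), P (f i * x), P (k i * x)
                            & P (kV i * x)]) -> forall x, P x) ->
    (forall v : M, exists x : A, v = x *: v0) ->
  [/\ forall t u, B (yfamily y t) (yfamily y u) = (t == u)%:R,
      forall (s : seq yindex) (a : yindex -> K), uniq s ->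
        \sum_(t <- s) a t *:: yfamily y t = 0 -> forall t, t \in s -> a t = 0
    & forall v : M, exists (s : seq yindex) (a : yindex -> K),
        v = \sum_(t <- s) a t *:: yfamily y t].
Proof.
move=> rtP gen cyc.
have rtP' l m i j : (i <= l)%N -> (j <= l)%N -> rt l m i j ^+ 2 =
    qint q 2 ^+ j * dnorm q l i * dnorm Q l j * B (uv l m) (uv l m).
  by move=> il jl; rewrite rtP // /c /uv /wv scalerA.
have yE t : yfamily y t = yv rt t.
  case: t => l [[m i] j]; rewrite /yv /= /y /bv /uv /wv; congr (_ *: _).
  by rewrite !scalerA.
split=> [t u|s a us|v].
- by rewrite !yE B_yv.
- by under eq_bigr do rewrite yE; exact: yv_free.
- have [x ->] := cyc v; have [s [a ->]] := yv_span rtP' (in_span_total gen x).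
  by exists s, a; apply: eq_bigr => t _; rewrite yE.
Qed.

End Form.
End Module.
End Relations.

(** * The base module *)

(** Every element lifts to the free algebra, whose monomials are words; induction on words and then
    on the support gives the claim. *)
Lemma uq_ind (K : fieldType) (q : K) (P : Uq q -> Prop) :
    P 1 -> (forall a x y, P x -> P y -> P (a *: x + y)) ->
    (forall g x, P x -> P (uq_gen q g * x)) ->
  forall x, P x.
Proof.
move=> P1 PD Pg x; case: (@to_quot_alg_surj _ _ _ (uq_proper q) x) => y ->.
have P0 : P 0 by have := PD (-1) 1 1 P1 P1; rewrite scaleN1r addNr.
have Pw (m : {fmonom gen}) : P (to_quot_alg (uq_proper q) (<< m >> : free_alg K)).
  case: m => s; elim: s => [|g s IH].
    have -> : FMonom [::] = mone :> {fmonom gen}.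
      by apply: val_inj; rewrite /= fm1.
    exact: P1.
  have -> : (<< FMonom (g :: s) >> : free_alg K) =
      free_gen K g * (<< FMonom s >> : free_alg K).
    rewrite free_gen.unlock; apply/esym; apply: etrans (fgmulUU _ _ _ _) _.
    rewrite mul1r; congr (<< _ *g _ >>); apply: val_inj.
    by rewrite /= fmM fmU.
  by rewrite rmorphM; apply: Pg.
rewrite [y]monalgE; elim: (finmap.enum_fset (msupp y)) => [|m s IH].
  by rewrite big_nil raddf0.
rewrite big_cons raddfD /=.
have -> : (<< y@_m *g m >> : free_alg K) = y@_m *: (<< m >> : free_alg K).
  by apply/malgP => m'; rewrite mcoeffZ !mcoeffU mulrnAr mulr1.
by rewrite linearZ; apply: PD => //; exact: Pw.
Qed.

Lemma quot_mod_rel (S : nzRingType) (V : lmodType S) (G : V -> Prop) (g : V) :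
  G g -> to_quot_mod G g = 0.
Proof.
move=> Gg; rewrite -(raddf0 (to_quot_mod G)); apply/to_quot_modE.
by rewrite subr0; apply/submod_genP => T _; apply.
Qed.

Section BaseModule.
Variables (K : fieldType) (q : K) (wt : 'I_3 -> K).
Local Notation v0 := (base_vector q wt).

Lemma verma_rel_act (x : Uq q) :
  verma_rel wt x -> x *: verma_vector q wt = 0.
Proof.
move=> xG; have xv : to_quot_mod (@verma_rel K q wt) (x : (Uq q)^o) = 0.
  exact: quot_mod_rel.
transitivity (to_quot_mod (@verma_rel K q wt) (x : (Uq q)^o)); last exact: xv.
by rewrite /verma_vector -linearZ; congr to_quot_mod; exact: mulr1.
Qed.

Lemma base_act (x : Uq q) :
  x *: v0 = to_quot_mod (@base_rel K q wt) (x *: verma_vector q wt).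
Proof. by rewrite linearZ. Qed.

Lemma uE_base i : uE q i *: v0 = 0.
Proof. by rewrite base_act verma_rel_act ?raddf0 //; exact: VermaE. Qed.

Lemma uK_base i : uK q i *: v0 = ((wt i)%:A : Uq q) *: v0.
Proof.
apply/eqP; rewrite -subr_eq0 -scalerBl; apply/eqP.
by rewrite base_act verma_rel_act ?raddf0 //; exact: VermaK.
Qed.

Lemma uF1_base : uF q n1 *: v0 = 0.
Proof. by rewrite base_act; apply: quot_mod_rel; exact: BaseF1. Qed.

Lemma uF3_base : uF q n3 *: v0 = 0.
Proof. by rewrite base_act; apply: quot_mod_rel; exact: BaseF3. Qed.

Lemma f_delta_base : f_delta q *: v0 = 0.
Proof. by rewrite base_act; apply: quot_mod_rel; exact: BaseFdelta. Qed.

Lemma base_cyclic (v : base_module q wt) : exists x : Uq q, v = x *: v0.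
Proof.
case: (to_quot_mod_surj v) => w ->; case: (to_quot_mod_surj w) => x ->.
exists x; rewrite base_act; congr to_quot_mod.
by rewrite /verma_vector -linearZ; congr to_quot_mod; apply/esym; exact: mulr1.
Qed.

End BaseModule.

Lemma uq_gen_ind (K : fieldType) (q : K) (P : Uq q -> Prop) :
    P 1 -> (forall a x y, P x -> P y -> P (a *: x + y)) ->
    (forall i x, P x -> [/\ P (uE q i * x), P (uF q i * x), P (uK q i * x)
                          & P (uKV q i * x)]) ->
  forall x, P x.
Proof.
move=> P1 PD Pg; apply: uq_ind P1 PD _ => g x Px.
by case: g => i; have [h1 h2 h3 h4] := Pg i x Px;
  [exact: h1|exact: h2|exact: h3|exact: h4].
Qed.

(** * Powers of q and the base weight *)

Section Weights.
Variable R : realType.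

Lemma cexpD (x y : R[i]) : cexp (x + y) = cexp x * cexp y.
Proof.
case: x y => a b [c d]; apply/eqP; rewrite eq_complex /= expRD cosD sinD.
by apply/andP; split; apply/eqP; ring.
Qed.

Lemma cpowD (hbar x y : R[i]) : cpow hbar (x + y) = cpow hbar x * cpow hbar y.
Proof. by rewrite /cpow mulrDr cexpD. Qed.

Lemma pairingC (u v : 'rV[R[i]]_3) : pairing u v = pairing v u.
Proof. by apply: eq_bigr => i _; rewrite mulrC. Qed.

(** This is 2 eps_2 = 2 alpha_2 + alpha_3. As q^((lambda, alpha_3)) = 1, the condition on eps_2
    fixes the square of the eigenvalue of q^(h_2). *)
Lemma pairing_simple_root2 (lam : 'rV[R[i]]_3) :
  2%:R * pairing lam (eps R[i] n2) =
    pairing (simple_root R[i] n2) lam + pairing (simple_root R[i] n2) lam +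
    pairing lam (simple_root R[i] n3).
Proof.
rewrite /pairing !big_ord_recl !big_ord0 /simple_root /eps /= !mxE /=.
ring.
Qed.

End Weights.

Theorem corollary2p11 (R : realType) (q hbar : R[i]) (lam : 'rV[R[i]]_3)
    (q_neq0 : q != 0)
    (q_not_root : forall n, (0 < n)%N -> q ^+ n != 1)
    (q_log : cexp hbar = q)
    (lam_alpha1 : cpow hbar (pairing lam (simple_root R[i] n1)) = 1)
    (lam_alpha3 : cpow hbar (pairing lam (simple_root R[i] n3)) = 1)
    (lam_eps1 : cpow hbar (2%:R * pairing lam (eps R[i] n1)) = - q ^- 2)
    (lam_eps2 : cpow hbar (2%:R * pairing lam (eps R[i] n2)) = - q ^- 2)
    (omega : Uq q -> Uq q) (omegaP : is_omega omega)
    (M := base_module q (highest_weight hbar lam))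
    (v0 := base_vector q (highest_weight hbar lam) : M)
    (form : M -> M -> R[i])
    (formP : contravariant_form omega form)
    (form_v0 : form v0 v0 = 1)
    (c := fun l k : nat =>
       let w := (uF q n2 ^+ l * f_theta q ^+ k) *: v0 in form w w)
    (* any choice of the complex square roots *)
    (rt : nat -> nat -> nat -> nat -> R[i])
    (rtP : forall l k i j, (i <= l)%N -> (j <= l)%N ->
       rt l k i j ^+ 2 =
         qint q 2 ^+ j * dnorm q l i * dnorm (q ^+ 2) l j * c l k)
    (y := fun l k i j : nat =>
       kscale (rt l k i j)^-1
         ((uF q n1 ^+ i * uF q n3 ^+ j * uF q n2 ^+ l * f_theta q ^+ k) *: v0)) :
  orthonormal_basis form (yfamily y).
Proof.
have wt1 : highest_weight hbar lam n1 = 1.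
  by rewrite /highest_weight pairingC.
have wt3 : highest_weight hbar lam n3 = 1.
  by rewrite /highest_weight pairingC.
have wt2 : highest_weight hbar lam n2 ^+ 2 = - q ^- 2.
  by rewrite -lam_eps2 pairing_simple_root2 !cpowD lam_alpha3 mulr1.
have k1v := uK_base q (highest_weight hbar lam) n1; rewrite wt1 in k1v.
have k2v := uK_base q (highest_weight hbar lam) n2.
have k3v := uK_base q (highest_weight hbar lam) n3; rewrite wt3 in k3v.
have form_k i u v : form (uK q i *: u) v = form u (uK q i *: v).
  by rewrite (form_contra formP) (omega_uK omegaP).
have form_f i u v :
    form (uF q i *: u) v = form u ((- (uKV q i * uE q i)) *: v).
  by rewrite (form_contra formP) (omega_uF omegaP).
(* At the generators of U_q, [fde] and [fth] are convertible to [f_delta] and [f_theta]. *)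
have ortho := @orthonormal_basis_monomials _ q q_neq0 q_not_root (Uq q) (uE q)
  (uF q) (uK q) (uKV q) (@uq_relations _ q) M v0 _ wt2 (@uE_base _ q _)
  k1v k2v k3v (uF1_base _ _) (uF3_base _ _) (f_delta_base _ _).
have {}ortho := ortho form (form_linear formP) (form_sym formP) form_k form_f
  form_v0 rt rtP (@uq_gen_ind _ q) (@base_cyclic _ q _).
case: ortho => y_ortho y_free y_span.
split.
- exact: y_ortho.
- exact: y_free.
- exact: y_span.
Qed.
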